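(* Let $1<p<\infty$, $0<\gamma<p$, $\lambda_\pm>0$, and let $u\in W^{1,p}(\Omega)$ be a local minimizer of $\mathcal{J}$. Then, in the sense of distributions, $$\Delta_p u_+=\gamma\lambda_+u_+^{\gamma-1}\ \text{ in }\{u_+>0\}\cap\Omega\qquad\text{and}\qquad \Delta_p u_-=\gamma\lambda_-u_-^{\gamma-1}\ \text{ in }\{u_->0\}\cap\Omega .$$
   Context: $\Omega\subset\mathbb{R}^N$ is open and bounded with Lipschitz boundary. The functional is $$\mathcal{J}[u]:=\int_\Omega \frac{|\nabla u|^p}{p}+F_\gamma(u)\,dx,\qquad F_\gamma(u):=\lambda_+(u_+)^\gamma+\lambda_-(u_-)^\gamma,\qquad u_\pm:=\max\{\pm u,0\}.$$ A function $u\in W^{1,p}(\Omega)$ is a local minimizer of $\mathcal{J}$ if $\mathcal{J}[u]\le\mathcal{J}[u+\varphi]$ for every open $\Omega'\Subset\Omega$ and every $\varphi\in W^{1,p}_0(\Omega')$ (extended by zero). Local minimizers are continuous (indeed $C^{1,\alpha}_{\mathrm{loc}}(\Omega)$), so the sets $\{u_\pm>0\}$ are open. $\Delta_p w:=\operatorname{div}(|\nabla w|^{p-2}\nabla w)$. *)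

(* Defs.v *)
From HB Require Import structures.
From mathcomp Require Import all_boot all_order all_algebra.
From mathcomp Require Import all_classical all_reals all_analysis.

Set Implicit Arguments.
Unset Strict Implicit.
Unset Printing Implicit Defensive.

Import Order.TTheory GRing.Theory Num.Theory.
Import numFieldNormedType.Exports.

Local Open Scope classical_set_scope.
Local Open Scope ring_scope.

Definition rV_display : measure_display -> measure_display.
Proof. exact. Qed.

(* R^N carries the product sigma-algebra, i.e. the one generated by the
   coordinate projections; over the reals this is the Borel sigma-algebra. *)
Section measurable_rV.
Context {d} {T : measurableType d}.
Variable n : nat.

Definition rV_coord (i : 'I_n) (x : 'rV[T]_n) : T := x ord0 i.

Let rV_set0 : g_sigma_preimage rV_coord set0.
Proof. exact: sigma_algebra0. Qed.

Let rV_setC A : g_sigma_preimage rV_coord A -> g_sigma_preimage rV_coord (~` A).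
Proof. exact: sigma_algebraC. Qed.

Let rV_bigcup (F : (set 'rV[T]_n)^nat) :
  (forall i, g_sigma_preimage rV_coord (F i)) ->
  g_sigma_preimage rV_coord (\bigcup_i (F i)).
Proof. exact: sigma_algebra_bigcup. Qed.

HB.instance Definition _ := @isMeasurable.Build (rV_display d)
  'rV[T]_n (g_sigma_preimage rV_coord) rV_set0 rV_setC rV_bigcup.

End measurable_rV.

Section measurable_rV_theory.
Context {d} {T : measurableType d}.

Lemma measurable_rV_coord n (i : 'I_n) :
  measurable_fun [set: 'rV[T]_n] (rV_coord i).
Proof.
move=> _ Y mY; rewrite setTI; apply: sub_sigma_algebra => /=.
rewrite -bigcup_seq/=; exists i => /=; first by rewrite mem_index_enum.
by exists Y => //; rewrite setTI.
Qed.

Lemma measurable_fun_rVP d' (S : measurableType d') n (f : S -> 'rV[T]_n) :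
  measurable_fun [set: S] f <->
  forall i, measurable_fun [set: S] (rV_coord i \o f).
Proof.
split=> [mf i|mf].
  by apply: measurableT_comp => //; exact: measurable_rV_coord.
have : g_sigma_preimage (fun i => rV_coord i \o f) `<=` measurable.
  apply: smallest_sub; first exact: sigma_algebra_measurable.
  case: n => [|n] in f mf *; first by rewrite big_ord0.
  rewrite -bigcup_mkord_ord; apply: bigcup_sub => i Ii.
  by move=> A [B mB <-]; exact: mf.
by rewrite g_sigma_preimage_comp => h _ A mA; apply: h; exists A.
Qed.

End measurable_rV_theory.

Section rV_cons.
Context {R : realType}.

(* measurableTypeR R is R with the sigma-algebra on which lebesgue_measure is
   declared; it has the same measurable sets as R. *)
Definition rV_cons n (z : measurableTypeR R * 'rV[R]_n) : 'rV[R]_n.+1 :=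
  row_mx (const_mx z.1 : 'rV[R]_1) z.2.

Definition rV_uncons n (x : 'rV[R]_n.+1) : measurableTypeR R * 'rV[R]_n :=
  (x ord0 ord0, \row_i x ord0 (lift ord0 i)).

Lemma rV_cons0 n (z : measurableTypeR R * 'rV[R]_n) :
  rV_cons z ord0 ord0 = z.1.
Proof. by rewrite mxE; case: splitP => j //= _; rewrite mxE. Qed.

Lemma rV_consS n (z : measurableTypeR R * 'rV[R]_n) i :
  rV_cons z ord0 (lift ord0 i) = z.2 ord0 i.
Proof.
rewrite mxE; case: splitP => j /=; first by rewrite ord1.
by rewrite /bump /= !add1n => -[ij]; congr (z.2 _ _); exact/val_inj.
Qed.

Lemma rV_consK n : cancel (@rV_cons n) (@rV_uncons n).
Proof.
move=> [a v]; rewrite /rV_uncons rV_cons0; congr pair.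
by apply/rowP => i; rewrite mxE rV_consS.
Qed.

Lemma measurable_rV_cons n : measurable_fun setT (@rV_cons n).
Proof.
apply/measurable_fun_rVP => i; case: (unliftP ord0 i) => [j|] ->.
  rewrite (_ : _ \o _ = rV_coord j \o snd).
    by apply: measurableT_comp => //; exact: measurable_rV_coord.
  by apply/funext => z /=; rewrite /rV_coord rV_consS.
rewrite (_ : _ \o _ = fst); first exact: measurable_fst.
by apply/funext => z /=; rewrite /rV_coord rV_cons0.
Qed.

Lemma measurable_rV_uncons n : measurable_fun setT (@rV_uncons n).
Proof.
apply/measurable_fun_pairP; split.
  exact: (measurable_rV_coord (ord0 : 'I_n.+1)).
apply/measurable_fun_rVP => i.
rewrite (_ : _ \o _ = rV_coord (lift ord0 i)); first exact: measurable_rV_coord.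
by apply/funext => x /=; rewrite /rV_coord mxE.
Qed.

End rV_cons.

Section lebesgue_measure_rV.
Context {R : realType}.
Local Open Scope ereal_scope.

Section step.
Variables (n : nat) (m : {sigma_finite_measure set 'rV[R]_n -> \bar R}).

Definition lebesgue_rV_step : set 'rV[R]_n.+1 -> \bar R :=
  pushforward (@lebesgue_measure R \x m) (@rV_cons R n).

Let lebesgue_rV_step0 : lebesgue_rV_step set0 = 0.
Proof. by rewrite /lebesgue_rV_step /pushforward preimage_set0 measure0. Qed.

Let lebesgue_rV_step_ge0 A : 0 <= lebesgue_rV_step A.
Proof. by apply: integral_ge0 => x _; exact: measure_ge0. Qed.

Let lebesgue_rV_step_sigma_additive : semi_sigma_additive lebesgue_rV_step.
Proof.
have mX (A : set 'rV[R]_n.+1) : measurable A ->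
    measurable (@rV_cons R n @^-1` A).
  by move=> mA; rewrite -[X in measurable X]setTI; exact: measurable_rV_cons.
move=> F mF tF mUF; rewrite /lebesgue_rV_step /pushforward preimage_bigcup.
apply: measure_semi_sigma_additive.
- by move=> i; exact: mX.
- apply/trivIsetP => /= i j _ _ ij; rewrite -preimage_setI.
  by move/trivIsetP : tF => /(_ _ _ _ _ ij) ->//; rewrite preimage_set0.
- by rewrite -preimage_bigcup; exact: mX.
Qed.

HB.instance Definition _ := isMeasure.Build _ _ _ lebesgue_rV_step
  lebesgue_rV_step0 lebesgue_rV_step_ge0 lebesgue_rV_step_sigma_additive.

Let lebesgue_rV_step_sigma_finite : sigma_finite setT lebesgue_rV_step.
Proof.
have /sigma_finiteP[F [TF ndF Foo]] := sigma_finiteT (@lebesgue_measure R).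
have /sigma_finiteP[G [TG ndG Goo]] := sigma_finiteT m.
exists (fun i => @rV_uncons R n @^-1` (F i `*` G i)).
  rewrite predeqE => x; split=> // _.
  have [i _ Fi] : (\bigcup_i F i) (rV_uncons x).1 by rewrite -TF.
  have [j _ Gj] : (\bigcup_i G i) (rV_uncons x).2 by rewrite -TG.
  exists (maxn i j) => //; split.
    by move: Fi; exact/subsetPset/ndF/leq_maxl.
  by move: Gj; exact/subsetPset/ndG/leq_maxr.
move=> i; have [mF Fioo] := Foo i; have [mG Gioo] := Goo i; split.
  rewrite -[X in measurable X]setTI; apply: measurable_rV_uncons => //.
  exact: measurableX.
rewrite /lebesgue_rV_step /pushforward -comp_preimage.
rewrite (_ : _ \o _ = id); last by apply/funext => z /=; rewrite rV_consK.
by rewrite preimage_id product_measure1E// lte_mul_pinfty// ge0_fin_numE.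
Qed.

HB.instance Definition _ := Measure_isSigmaFinite.Build _ _ _
  lebesgue_rV_step lebesgue_rV_step_sigma_finite.

End step.

(* N-dimensional Lebesgue measure, as the N-fold product of the
   one-dimensional one; R^0 is a single point and has mass 1. *)
Fixpoint lebesgue_rV n : {sigma_finite_measure set 'rV[R]_n -> \bar R} :=
  if n is n'.+1 then lebesgue_rV_step (lebesgue_rV n') else \d_(0%R : 'rV[R]_0).

Lemma lebesgue_rV_box n (A : 'I_n -> set R) : (forall i, measurable (A i)) ->
  lebesgue_rV n [set x | forall i, A i (x ord0 i)] =
  \prod_(i < n) lebesgue_measure (A i).
Proof.
elim: n A => [|n IH] A mA /=.
  rewrite big_ord0 /dirac indicE mem_set//.
  by case.
have mB : measurable [set x : 'rV[R]_n | forall i, A (lift ord0 i) (x ord0 i)].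
  rewrite (_ : mkset _ = \bigcap_(i in [set: 'I_n])
      (@rV_coord _ R n i @^-1` A (lift ord0 i))); last first.
    by apply/seteqP; split => x /= h i; [move=> _|]; exact: h.
  apply: fin_bigcap_measurable => // i _.
  by rewrite -[X in measurable X]setTI; exact: measurable_rV_coord.
rewrite big_ord_recl -(IH (fun i => A (lift ord0 i)))//.
rewrite /lebesgue_rV_step /pushforward -product_measure1E//; last exact: mA.
congr (product_measure1 _ _ _); apply/seteqP; split => [z|z] /=.
  move=> h; split; first by have := h ord0; rewrite rV_cons0.
  by move=> i; have := h (lift ord0 i); rewrite rV_consS.
move=> [h0 hS] i; case: (unliftP ord0 i) => [j|] ->.
  by rewrite rV_consS.
by rewrite rV_cons0.
Qed.

End lebesgue_measure_rV.

Section sobolev.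
Context {R : realType} {N : nat}.
Implicit Types (Omega U : set 'rV[R]_N) (f u v w phi : 'rV[R]_N -> R)
  (G H : 'rV[R]_N -> 'rV[R]_N) (p : R).

Local Notation mu := (@lebesgue_rV R N).

(* The library norm on row vectors is the sup norm. *)
Definition eucl_norm (x : 'rV[R]_N) : R := Num.sqrt (\sum_(i < N) x ord0 i ^+ 2).

Definition partial (i : 'I_N) f : 'rV[R]_N -> R := 'D_(delta_mx ord0 i) f.

Fixpoint Ck (k : nat) f : Prop :=
  if k is k'.+1 then
    [/\ continuous f,
        forall i x, derivable f x (delta_mx ord0 i) &
        forall i, Ck k' (partial i f)]
  else continuous f.

Definition smooth f := forall k, Ck k f.

Definition supp f := closure [set x | f x != 0].

Definition test_function U phi :=
  [/\ smooth phi, compact (supp phi) & supp phi `<=` U].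

Definition loc_integrable U f :=
  measurable_fun U f /\
  forall K, compact K -> K `<=` U -> mu.-integrable K (EFin \o f).

Definition weak_gradient U u G :=
  [/\ loc_integrable U u,
      forall i, loc_integrable U (fun x => G x ord0 i) &
      forall phi, test_function U phi -> forall i,
        \int[mu]_(x in U) (u x * partial i phi x) =
        - (\int[mu]_(x in U) (G x ord0 i * phi x))].

Definition in_Lp U p f := f \_ U \in Lfun mu p%:E.

Definition in_W1p U p u :=
  in_Lp U p u /\
  exists2 G, weak_gradient U u G & forall i, in_Lp U p (fun x => G x ord0 i).

Definition cvg_Lp U p (f_ : nat -> 'rV[R]_N -> R) f :=
  Lnorm mu p%:E (EFin \o ((f_ k \- f) \_ U)) @[k --> \oo] --> 0%E.

(* W^{1,p}_0(U): the closure of C_c^infty(U) in W^{1,p}(U); its elements are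
   extended by zero outside U. *)
Definition in_W1p0 U p phi :=
  [/\ in_Lp U p phi,
      forall x, ~ U x -> phi x = 0 &
      exists G, [/\ weak_gradient U phi G,
        forall i, in_Lp U p (fun x => G x ord0 i) &
        exists phi_ : nat -> 'rV[R]_N -> R,
          [/\ forall k, test_function U (phi_ k),
              cvg_Lp U p phi_ phi &
              forall i, cvg_Lp U p (fun k => partial i (phi_ k))
                                   (fun x => G x ord0 i)]]].

(* Near each boundary point, after an orthogonal change of coordinates,
   Omega is the strict epigraph of a Lipschitz function of N - 1 of the
   coordinates (col' k deletes the k-th one). *)
Definition lipschitz_boundary Omega :=
  forall x0, closure Omega x0 -> ~ interior Omega x0 ->
  exists (A : 'M[R]_N) (k : 'I_N) (psi : 'rV[R]_N.-1 -> R) (r : R),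
    [/\ A *m A^T = 1%:M, lipschitz psi, 0 < r &
        forall x, ball x0 r x ->
          (Omega x <-> psi (col' k (x *m A)) < (x *m A) ord0 k)].

Section functional.
Variables (Omega : set 'rV[R]_N) (p gamma lambdap lambdam : R).

Definition Fgamma (s : R) : R :=
  lambdap * (Num.max s 0) `^ gamma + lambdam * (Num.max (- s) 0) `^ gamma.

(* J[u], where G is any version of the weak gradient of u in Omega. *)
Definition functionalJ u G : \bar R :=
  (\int[mu]_(x in Omega) ((eucl_norm (G x)) `^ p / p + Fgamma (u x))%R%:E)%E.

(* Weak gradients are unique only almost everywhere; J does not depend on the
   versions G and H of the gradients of u and u + phi. *)
Definition local_minimizer u :=
  forall Omega', open Omega' -> compact (closure Omega') ->
    closure Omega' `<=` Omega ->
  forall phi, in_W1p0 Omega' p phi ->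
  forall G H, weak_gradient Omega u G -> weak_gradient Omega (u \+ phi) H ->
    (functionalJ u G <= functionalJ (u \+ phi)%R H)%E.

End functional.

Definition distr_div_eq U G f :=
  [/\ forall i, loc_integrable U (fun x => G x ord0 i),
      loc_integrable U f &
      forall phi, test_function U phi ->
        - (\int[mu]_(x in U) (\sum_(i < N) G x ord0 i * partial i phi x)) =
        \int[mu]_(x in U) (f x * phi x)].

(* G is the weak gradient of w, which is unique almost everywhere. The flux
   vanishes wherever G does, also when p < 2, since 0 `^ a = 0 for a != 0. *)
Definition p_laplacian_eq U p w f :=
  exists2 G, weak_gradient U w G &
    distr_div_eq U (fun x => (eucl_norm (G x)) `^ (p - 2) *: G x) f.

(* The representative of u that is continuous in Omega; its values outside
   Omega are irrelevant. *)
Definition continuous_representative Omega u v :=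
  {in Omega, continuous v} /\ ae_eq mu Omega v u.

End sobolev.

(* Main.v *)
Require Import Defs.
From HB Require Import structures.
From mathcomp Require Import all_boot all_order all_algebra.
From mathcomp Require Import all_classical all_reals all_analysis.
From mathcomp Require Import measurable_realfun ring lra.

(* The idea is to test minimality against v + t phi, with phi a test function
   supported in {v > 0} and t > 0 small. Convexity of |z|^p bounds the increment
   of the gradient term by t |z|^(p-2) z . grad phi, z = G + t grad phi, while
   F_gamma is differentiable at the values of v on supp phi, which are bounded
   away from 0. Hence the integral of
     |z|^(p-2) z . grad phi + (F_gamma(v + t phi) - F_gamma(v)) / t
   is nonnegative; as t -> 0 dominated convergence yields one inequality in the
   Euler-Lagrange equation, and -phi yields the other. The equation for the
   negative part is the same statement for -v, with lambda_+ and lambda_-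
   exchanged. *)

Import Order.TTheory GRing.Theory Num.Theory.
Import numFieldNormedType.Exports.
Import Num.Def.

Local Open Scope classical_set_scope.
Local Open Scope ring_scope.

Set Implicit Arguments.
Unset Strict Implicit.
Unset Printing Implicit Defensive.

(** * Borel sets and Lebesgue measure on row vectors *)

(** The tangent inequality for |z|^p / p is applied at the perturbed gradient z and not at G: there
    it bounds the energy increment from above, so minimality makes the integral of the bound
    nonnegative, and the limit t -> 0 asks only for continuity of the flux z -> |z|^(p-2) z. For p <
    2 the factor |z|^(p-2) is singular at 0, so the flux is always controlled through its size
    |z|^(p-1). Finiteness carries the rest. J[v] has to be finite in order to cancel, which follows
    from G in L^p, gamma < p and the finite measure of Omega; the dominating function comes from
    (|G| + C)^p. A separate obstacle is that a test function is an admissible perturbation only once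
    its classical gradient is known to be a weak gradient. Lebesgue measure being an iterated
    product, the integration by parts behind this is obtained from Fubini and the one-dimensional
    fundamental theorem of calculus. *)

Section euclidean_space.
Context {R : realType} {n : nat}.
Implicit Types (x : 'rV[R]_n) (U K : set 'rV[R]_n) (f : 'rV[R]_n -> R).

Local Notation mu := (@lebesgue_rV R n).

Lemma rV_entry_le_norm x i : `|x ord0 i| <= `|x|.
Proof.
rewrite [leRHS]/normr /= mx_normrE.
by apply/bigmax_geP; right; exists (ord0, i).
Qed.

Lemma rV_norm_le x (M : R) : 0 <= M -> (forall i, `|x ord0 i| <= M) -> `|x| <= M.
Proof.
move=> M0 h; rewrite [leLHS]/normr /= mx_normrE.
by apply/bigmax_leP; split=> // -[i j] _ /=; rewrite (ord1 i).
Qed.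

Lemma rV_ball_measurable x (e : R) : measurable (ball x e).
Proof.
have [e0|e0] := ltP 0 e; last first.
  rewrite (_ : ball x e = set0) ?measurable0//.
  apply/seteqP; split=> // y []; by rewrite ltNge e0.
rewrite (_ : ball x e = \bigcap_(i in [set: 'I_n])
    (@rV_coord _ R n i @^-1` ball (x ord0 i) e)); last first.
  apply/seteqP; split=> [y [_ h] i _|y h]; first exact: h.
  by split=> // i j; rewrite (ord1 i); exact: (h j).
apply: fin_bigcap_measurable => // i _.
rewrite -[X in measurable X]setTI; apply: measurable_rV_coord => //.
exact: measurable_ball.
Qed.

(** The sigma-algebra is generated by the coordinates, so openness has to be reduced to boxes. Balls
    of the sup norm are boxes, and [U] is the union of the countably many balls with rational centre
    and radius that it contains. *)
Lemma rV_open_measurable U : open U -> measurable U.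
Proof.
move=> oU.
pose B (c : 'rV[rat]_n * rat) : set 'rV[R]_n :=
  let b := ball (map_mx ratr c.1 : 'rV[R]_n) (ratr c.2 : R) in
  if `[< b `<=` U >] then b else set0.
rewrite (_ : U = \bigcup_c B c).
  apply: countable_bigcupT_measurable => [|c]; first exact: countableP.
  rewrite /B; case: ifP => // _.
  exact: rV_ball_measurable.
apply/seteqP; split=> [x Ux|x [c _]]; last first.
  by rewrite /B; case: asboolP => // /[apply].
have /nbhs_ballP[e /= e0 xeU] : nbhs x U by move: oU; rewrite openE; apply.
(* With a radius below [e / 2], any ball of that radius containing [x] stays inside the ball of
   radius [e] around [x]. *)
have [q] : exists q, (ratr q : R) \in `]0, (e / 2)[.
  by apply: rat_in_itvoo; rewrite divr_gt0.
rewrite in_itv/= => /andP[q0 qe].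
have h (i : 'I_n) : exists r, (ratr r : R) \in `](x ord0 i - ratr q), (x ord0 i + ratr q)[.
  by apply: rat_in_itvoo; rewrite ltrD2l gt0_cp// q0.
have cq : ball (map_mx ratr (\row_i (projT1 (cid (h i)))) : 'rV[R]_n) (ratr q) x.
  split=> // i j; rewrite (ord1 i) !mxE; case: cid => r /=.
  rewrite in_itv/= => /andP[h1 h2].
  by rewrite /ball/= ltr_distlC; lra.
exists (\row_i (projT1 (cid (h i))), q) => //; rewrite /B /=.
case: asboolP => //; case => y cy; apply: xeU.
rewrite (splitr e).
apply: (@ball_triangle _ _ (map_mx ratr (\row_i (projT1 (cid (h i)))) : 'rV[R]_n)).
- by apply: ball_sym; apply: le_ball cq; exact: ltW.
- by apply: le_ball cy; exact: ltW.
Qed.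

Lemma rV_continuous_measurable U f :
  open U -> {in U, continuous f} -> measurable_fun U f.
Proof.
move=> oU cf; apply: (measurability _ (RGenOpens.measurableE R)).
move=> _ [_ [a [b ->] <-]]; apply: rV_open_measurable.
rewrite openE => x [Ux fx]; apply: filterI.
  by apply: open_nbhs_nbhs; split.
by apply: (cf x (mem_set Ux)); apply: open_nbhs_nbhs; split => //; exact: interval_open.
Qed.

Lemma rV_continuous_measurableTS (D : set 'rV[R]_n) f :
  continuous f -> measurable_fun D f.
Proof.
move=> cf; apply: measurable_funTS; apply: rV_continuous_measurable.
  exact: openT.
by move=> x _; exact: cf.
Qed.

Lemma rV_compact_measurable K : compact K -> measurable K.
Proof.
move/compact_closed => /(_ (@norm_hausdorff _ _)) cK.
rewrite -(setCK K); apply: measurableC; apply: rV_open_measurable.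
by rewrite openC.
Qed.

Lemma rV_closed_ball_compact (M : R) : compact [set x : 'rV[R]_n | `|x| <= M].
Proof.
apply: bounded_closed_compact.
  exists M; split; first exact: num_real.
  by move=> y My x /= /le_trans; apply; exact: ltW.
apply: (preimage_closed _ (@closed_le _ M)) => y _.
exact: norm_continuous.
Qed.

(** The ball lies in the cube with sides [[- M, M]], whose measure is a finite product of finite
    lengths by [lebesgue_rV_box]. *)
Lemma lebesgue_rV_ball_finite (M : R) : (mu [set x : 'rV[R]_n | (`|x| <= M)%R] < +oo)%E.
Proof.
have mbox : measurable [set x : 'rV[R]_n | forall i, x ord0 i \in `[- M, M]].
  rewrite (_ : mkset _ = \bigcap_(i in [set: 'I_n])
      (@rV_coord _ R n i @^-1` `[- M, M])); last first.
    by apply/seteqP; split => x /= h i; [move=> _|]; exact: h.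
  apply: fin_bigcap_measurable => // i _.
  by rewrite -[X in measurable X]setTI; exact: measurable_rV_coord.
apply: (@le_lt_trans _ _ (mu [set x | forall i, x ord0 i \in `[- M, M]])).
  apply: le_measure; [|exact: mem_set|].
    exact: mem_set (rV_compact_measurable (@rV_closed_ball_compact M)).
  move=> x /= xM i; rewrite in_itv/= -ler_norml.
  exact: le_trans (rV_entry_le_norm x i) xM.
rewrite (lebesgue_rV_box (A := fun=> `[- M, M]%classic))//.
rewrite ltey; apply/negP => /eqP h.
have {h} := congr1 (fun a => a \is a fin_num) h.
suff -> : (\prod_(i < n) lebesgue_measure (`[(- M)%R, M]%classic : set R))%E \is a fin_num by [].
by apply: prode_fin_num => i _; rewrite lebesgue_measure_itv; case: ifP.
Qed.

Lemma bounded_set_finite U : measurable U -> bounded_set U -> (mu U < +oo)%E.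
Proof.
move=> mU [M [_ UM]]; apply: le_lt_trans (lebesgue_rV_ball_finite (M + 1)).
apply: le_measure; first exact: mem_set.
- exact: mem_set (rV_compact_measurable (@rV_closed_ball_compact (M + 1))).
- by move=> x Ux; apply: (UM (M + 1)) => //; rewrite ltrDl.
Qed.

Lemma rV_compact_finite K : compact K -> (mu K < +oo)%E.
Proof.
move=> cK; apply: bounded_set_finite; first exact: rV_compact_measurable.
exact: compact_bounded.
Qed.

Lemma finite_integrable_cst U (c : R) : measurable U -> (mu U < +oo)%E ->
  mu.-integrable U (EFin \o (cst c)).
Proof.
move=> mU fU; apply: measurable_bounded_integrable => //.
exists `|c|; split; first exact: num_real.
by move=> B B0 x _ /=; exact: ltW.
Qed.

End euclidean_space.

(** * Integrals of partial derivatives *)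

Section slicing.
Context {R : realType}.

(** Both difference quotients are the same function of [h]. This identifies a partial derivative of
    [f] with a derivative of one of its slices; the two normed spaces are arbitrary so that a slice
    may keep one coordinate or all the others. *)
Lemma derive_affine_comp (V W : normedModType R) (f : W -> R) (g : V -> R)
    (x v : V) (y w : W) : (forall h, g (h *: v + x) = f (h *: w + y)) ->
  (derivable g x v <-> derivable f y w) /\ 'D_v g x = 'D_w f y.
Proof.
move=> gf.
have gxfy : g x = f y by have := gf 0; rewrite !scale0r !add0r.
have E : (fun h => h^-1 *: ((g \o shift x) (h *: v) - g x)) =
    (fun h => h^-1 *: ((f \o shift y) (h *: w) - f y)).
  by apply/funext => h /=; rewrite gf gxfy.
by split; rewrite /derivable /derive E.
Qed.

Lemma rV_consD0 n (a h : R) (z : 'rV[R]_n) :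
  rV_cons (h + a, z) = h *: delta_mx ord0 ord0 + rV_cons (a, z).
Proof.
apply/rowP => i; rewrite [RHS]mxE [X in _ = X + _]mxE [X in _ = h * X + _]mxE.
case: (unliftP ord0 i) => [j|] ->.
  by rewrite !rV_consS /= mulr0 add0r.
by rewrite !rV_cons0 /= mulr1.
Qed.

Lemma rV_consDS n (j : 'I_n) (a h : R) (z : 'rV[R]_n) :
  rV_cons (a, h *: delta_mx ord0 j + z) =
  h *: delta_mx ord0 (lift ord0 j) + rV_cons (a, z).
Proof.
apply/rowP => i; rewrite [RHS]mxE [X in _ = X + _]mxE [X in _ = h * X + _]mxE.
case: (unliftP ord0 i) => [k|] ->.
  by rewrite !rV_consS /= !mxE /= (inj_eq lift_inj).
by rewrite !rV_cons0 /= mulr0 add0r.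
Qed.

Lemma continuous_rV_cons0 n (z : 'rV[R]_n) :
  continuous (fun a : R => rV_cons (a, z)).
Proof.
move=> a; have -> : (fun a => rV_cons (a, z)) =
    (fun a : R => a *: delta_mx ord0 ord0 + rV_cons (0, z)).
  by apply/funext => b; rewrite -rV_consD0 addr0.
apply: cvgD; last exact: cvg_cst.
by apply: cvgZr_tmp; exact: cvg_id.
Qed.

Lemma continuous_rV_consS n (a : R) :
  continuous (fun z : 'rV[R]_n => rV_cons (a, z)).
Proof.
move=> z; apply/(@cvgrPdist_lt _ _ _ (nbhs z)) => e e0; near=> w.
apply: (@le_lt_trans _ _ `|z - w|).
  apply: rV_norm_le => // i; rewrite mxE [X in _ + X]mxE.
  case: (unliftP ord0 i) => [k|] ->; last by rewrite !rV_cons0 subrr normr0.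
  rewrite !rV_consS /=.
  by have := rV_entry_le_norm (z - w) k; rewrite !mxE.
by near: w; apply: cvgr_dist_lt => //; exact: cvg_id.
Unshelve. all: by end_near. Qed.

Lemma norm_rV_cons0 n (a : R) (z : 'rV[R]_n) : `|a| <= `|rV_cons (a, z)|.
Proof. by have := rV_entry_le_norm (rV_cons (a, z)) ord0; rewrite rV_cons0. Qed.

Lemma norm_rV_consS n (a : R) (z : 'rV[R]_n) : `|z| <= `|rV_cons (a, z)|.
Proof.
apply: rV_norm_le => // i.
by have := rV_entry_le_norm (rV_cons (a, z)) (lift ord0 i); rewrite rV_consS.
Qed.

Lemma compact_support_integrable n (K : set 'rV[R]_n) (g : 'rV[R]_n -> R) (C : R) :
  compact K -> measurable_fun setT g -> (forall x, `|g x| <= C) ->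
  (forall x, ~ K x -> g x = 0) ->
  (lebesgue_rV n).-integrable setT (EFin \o g).
Proof.
move=> cK mg gC g0.
have mK := rV_compact_measurable cK.
rewrite (_ : EFin \o g = (EFin \o g) \_ K); last first.
  apply/funext => x; rewrite patchE; case: ifPn => //.
  by rewrite notin_setE => /g0 /= ->.
apply/(integrable_mkcond _ mK); apply: measurable_bounded_integrable => //.
- exact: rV_compact_finite.
- exact: measurable_funTS.
- exists C; split; first exact: num_real.
  by move=> M CM x _ /=; apply: (le_trans (gC x)); exact: ltW.
Qed.

Lemma continuous_compact_bounded (T : topologicalType) (K : set T) (g : T -> R) :
  compact K -> {in K, continuous g} -> exists C, forall x, K x -> `|g x| <= C.
Proof.
move=> cK cg.
have /compact_bounded [M [_ hM]] : compact (g @` K).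
  apply: continuous_compact => //; apply: continuous_in_subspaceT => x xK.
  exact: cg.
by exists (M + 1) => x Kx; apply: (hM (M + 1)); [rewrite ltrDl|exists x].
Qed.

Lemma continuous_compact_support_integrable n (K : set 'rV[R]_n) (g : 'rV[R]_n -> R) :
  compact K -> continuous g -> (forall x, ~ K x -> g x = 0) ->
  (lebesgue_rV n).-integrable setT (EFin \o g).
Proof.
move=> cK cg g0.
have [C gC] := continuous_compact_bounded cK (in1W cg).
apply: (@compact_support_integrable _ K g `|C|) => //.
  exact: rV_continuous_measurableTS.
move=> x; have [Kx|nKx] := pselect (K x).
  exact: le_trans (gC x Kx) (ler_norm _).
by rewrite g0// normr0.
Qed.

Lemma partial_eq0 n (i : 'I_n) (f : 'rV[R]_n -> R) x :
  (\forall y \near x, f y = 0) -> partial i f x = 0.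
Proof.
move=> fx; rewrite /partial -(derive_cst (0 : R) x (delta_mx ord0 i)).
exact: near_eq_derive.
Qed.

Lemma integral_derive_compact_support (f : R -> R) (M : R) :
  continuous (derive1 f) -> (forall x, derivable f x 1) ->
  (forall x, M < `|x| -> f x = 0) ->
  (\int[lebesgue_measure]_x (derive1 f x)%:E = 0)%E.
Proof.
(* [M] may be negative; this [L] exceeds both [M] and 0, so that [f] vanishes at [- L] and [L]. *)
move=> cf' df f0; pose L := `|M| + 1.
have ML : M < L by rewrite (le_lt_trans (ler_norm M))// ltrDl.
have L0 : 0 < L by rewrite ltr_wpDl.
have f'0 x : x \notin `[- L, L]%classic -> derive1 f x = 0.
  rewrite notin_setE /= in_itv/= -ler_norml => /negP; rewrite -ltNge => Lx.
  rewrite derive1E -(derive_cst (0 : R) x 1); apply: near_eq_derive.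
  have : \forall y \near x, L < `|y|.
    have nx : normr y @[y --> x] --> `|x| by exact: norm_continuous.
    exact: (cvgr_gt `|x| nx L Lx).
  by apply: filterS => y Ly; rewrite f0// (lt_trans ML).
transitivity (\int[lebesgue_measure]_(x in `[(- L)%R, L]) (derive1 f x)%:E)%E.
  rewrite [RHS]integral_mkcond; apply: eq_integral => x _.
  by rewrite patchE; case: ifPn => // /f'0 ->.
rewrite (@continuous_FTC2 _ (derive1 f) f); last 4 first.
- lra.
- exact: continuous_subspaceT.
- have cf : continuous f.
    by move=> x; apply: differentiable_continuous; apply/derivable1_diffP.
  split; first by move=> x _; exact: df.
    exact: cvg_at_right_filter (cf _).
  exact: cvg_at_left_filter (cf _).
- by [].
rewrite (f0 L) ?ger0_norm ?(ltW L0)//.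
by rewrite (f0 (- L)) ?normrN ?ger0_norm ?(ltW L0)// subee.
Qed.

End slicing.

Section integral_partial_derivative.
Context {R : realType}.
Local Open Scope ereal_scope.

Lemma integrable_rV_cons n (g : 'rV[R]_n.+1 -> \bar R) :
  (lebesgue_rV n.+1).-integrable setT g ->
  (@lebesgue_measure R \x lebesgue_rV n).-integrable setT (g \o @rV_cons R n).
Proof.
move=> /integrableP[mg gfin]; apply/integrableP; split.
  by apply: measurableT_comp => //; exact: measurable_rV_cons.
rewrite -(@ge0_integral_pushforward _ _ _ _ _ (@rV_cons R n)
  (@measurable_rV_cons R n) (@lebesgue_measure R \x lebesgue_rV n) setT
  (fun x => `|g x|))//.
exact: measurableT_comp.
Qed.

(** [lebesgue_rV n.+1] is by construction the image of the product measure under [rV_cons], so this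
    is the change of variables for image measures; it opens the way to Fubini. *)
Lemma integral_rV_cons n (g : 'rV[R]_n.+1 -> \bar R) :
  (lebesgue_rV n.+1).-integrable setT g ->
  \int[lebesgue_rV n.+1]_x g x =
  \int[@lebesgue_measure R \x lebesgue_rV n]_z g (rV_cons z).
Proof.
move=> ig; have [mg _] := integrableP _ _ _ ig.
exact: (@integral_pushforward _ _ _ _ _ (@rV_cons R n)
  (@measurable_rV_cons R n) (@lebesgue_measure R \x lebesgue_rV n) setT g mg
  (integrable_rV_cons ig) measurableT).
Qed.

(* rV_cons splits off the first coordinate: the inner integral vanishes by the
   fundamental theorem of calculus if i = 0, and by induction otherwise. *)
Lemma integral_partial n (i : 'I_n) (f : 'rV[R]_n -> R) (M : R) :
  continuous f -> (forall x, derivable f x (delta_mx ord0 i)) ->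
  continuous (partial i f) -> (forall x, (M < `|x|)%R -> f x = 0%R) ->
  \int[lebesgue_rV n]_x (partial i f x)%:E = 0.
Proof.
elim: n i f => [[]//|n IH] i f cf df cf' f0.
have ip : (lebesgue_rV n.+1).-integrable setT (EFin \o partial i f).
  apply: (@continuous_compact_support_integrable _ _ [set x | (`|x| <= M)%R]) => //.
    exact: rV_closed_ball_compact.
  move=> x /negP; rewrite -ltNge => Mx; apply: partial_eq0.
  have nx : (normr y @[y --> x] --> `|x|)%R by exact: norm_continuous.
  near=> y; apply: f0; near: y; exact: (cvgr_gt `|x| nx M Mx).
rewrite integral_rV_cons//.
case: (unliftP ord0 i) => [j|] ij.
- rewrite -(integral12_prod_meas1 (integrable_rV_cons ip)).
  apply: integral0_eq => a _ /=.
  have dj z := derive_affine_comp (f := f) (g := fun z => f (rV_cons (a, z)))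
     (x := z) (v := delta_mx ord0 j) (y := rV_cons (a, z))
     (w := delta_mx ord0 (lift ord0 j))
     (fun h => congr1 f (rV_consDS j a h z)).
  have dE : (fun z => partial i f (rV_cons (a, z))) =
      partial j (fun z => f (rV_cons (a, z))).
    by apply/funext => z; rewrite /partial (dj z).2 ij.
  transitivity (\int[lebesgue_rV n]_z (partial j (fun z => f (rV_cons (a, z))) z)%:E).
    by apply: eq_integral => z _; rewrite -dE.
  apply: IH.
  + move=> z; apply: continuous_comp; [exact: continuous_rV_consS|exact: cf].
  + by move=> z; apply/(dj z).1; rewrite -ij.
  + rewrite -dE => z.
    by apply: continuous_comp; [exact: continuous_rV_consS|exact: cf'].
  + by move=> z Mz; apply: f0; apply: (lt_le_trans Mz); exact: norm_rV_consS.
- rewrite -(integral21_prod_meas1 (integrable_rV_cons ip)).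
  apply: integral0_eq => z _ /=.
  (* On the real line an increment in direction 1 reads [h *: 1]; [mulr1] brings it to the [h] of
     [rV_consD0]. *)
  have dj a := derive_affine_comp (f := f) (g := fun a : R => f (rV_cons (a, z)))
     (x := a) (v := 1%R) (y := rV_cons (a, z))
     (w := delta_mx ord0 ord0)
     (fun h => congr1 f (etrans
       (congr1 (fun h => rV_cons (h + a, z)%R) (mulr1 h)) (rV_consD0 a h z))).
  have dE : (fun a : R => partial i f (rV_cons (a, z))) =
      derive1 (fun a : R => f (rV_cons (a, z))).
    by apply/funext => a; rewrite derive1E (dj a).2 /partial ij.
  transitivity (\int[lebesgue_measure]_a (derive1 (fun a : R => f (rV_cons (a, z))) a)%:E).
    by apply: eq_integral => a _; rewrite -dE.
  apply: (@integral_derive_compact_support _ _ M).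
  + rewrite -dE => a.
    by apply: continuous_comp; [exact: continuous_rV_cons0|exact: cf'].
  + by move=> a; apply/(dj a).1; rewrite -ij.
  + by move=> a Ma; apply: f0; apply: (lt_le_trans Ma); exact: norm_rV_cons0.
Unshelve. all: by end_near. Qed.

End integral_partial_derivative.

(** * Test functions and weak gradients *)

Section test_functions.
Context {R : realType} {N : nat}.
Implicit Types (U V K : set 'rV[R]_N) (f g u phi psi : 'rV[R]_N -> R)
  (G H : 'rV[R]_N -> 'rV[R]_N).

Local Notation mu := (@lebesgue_rV R N).

Definition grad f : 'rV[R]_N -> 'rV[R]_N := fun x => \row_i partial i f x.

Lemma smooth_continuous f : smooth f -> continuous f.
Proof. by move=> /(_ 0%N). Qed.

Lemma smooth_derivable f i x : smooth f -> derivable f x (delta_mx ord0 i).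
Proof. by move=> /(_ 1%N)[]. Qed.

Lemma smooth_continuous_partial f i : smooth f -> continuous (partial i f).
Proof. by move=> /(_ 1%N)[_ _ /(_ i)]. Qed.

Lemma Ck_scale k f (t : R) : Ck k f -> Ck k (t \*o f).
Proof.
have ct g : continuous g -> continuous (t \*o g).
  by move=> cg x; apply: (@cvgM R _ (nbhs x) _ (fun=> t) g t (g x)); [exact: cvg_cst|exact: cg].
elim: k f => [f|k IH f [cf df pf]] /=; first exact: ct.
split.
- exact: ct.
- by move=> i x; exact: (derivableZ (k := t) (df i x)).
- move=> i; rewrite (_ : partial i _ = t \*o partial i f); first exact: IH (pf i).
  by apply/funext => x; rewrite /partial (deriveMl t (df i x)).
Qed.

Lemma continuous_mul f g : continuous f -> continuous g -> continuous (f \* g).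
Proof.
by move=> cf cg x; apply: (@cvgM R _ (nbhs x) _ f g (f x) (g x));
  [exact: cf|exact: cg].
Qed.

Lemma smooth_scale f (t : R) : smooth f -> smooth (t \*o f).
Proof. by move=> sf k; exact: Ck_scale. Qed.

Lemma partial_scale f (t : R) i : smooth f ->
  partial i (t \*o f) = t \*o partial i f.
Proof.
by move=> sf; apply/funext => x; rewrite /partial deriveMl//; exact: smooth_derivable.
Qed.

Lemma grad_scale f (t : R) x : smooth f -> grad (t \*o f) x = t *: grad f x.
Proof. by move=> sf; apply/rowP => i; rewrite !mxE partial_scale. Qed.

Lemma supp_eq0 f x : ~ supp f x -> f x = 0.
Proof.
by move=> sx; apply: contra_notP sx => /eqP fx; exact: subset_closure.
Qed.

Lemma supp_partial_eq0 f i x : ~ supp f x -> partial i f x = 0.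
Proof.
move=> sx; apply: partial_eq0; near=> y; apply: supp_eq0.
near: y; apply: open_nbhs_nbhs; split => //.
by apply: closed_openC; exact: closed_closure.
Unshelve. all: by end_near. Qed.

Lemma test_function_scale U phi (t : R) :
  test_function U phi -> test_function U (t \*o phi).
Proof.
move=> [sphi cphi phiU].
have st : supp (t \*o phi) `<=` supp phi.
  by apply: closureS => x /=; rewrite mulf_eq0 negb_or => /andP[].
split; first exact: smooth_scale.
- by apply: subclosed_compact cphi st; exact: closed_closure.
- exact: subset_trans st phiU.
Qed.

Lemma test_functionS U V phi : U `<=` V -> test_function U phi -> test_function V phi.
Proof. by move=> UV [sphi cphi phiU]; split => //; exact: subset_trans phiU UV. Qed.

Lemma Rintegral_zero_outside U (h : 'rV[R]_N -> R) :
  (forall x, ~ U x -> h x = 0) -> \int[mu]_(x in U) h x = \int[mu]_x h x.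
Proof.
move=> h0; rewrite Rintegral_mkcond; congr (Rintegral _ _ _).
apply/funext => x; rewrite patchE; case: ifPn => //.
by rewrite notin_setE => /h0.
Qed.

(** The product of [phi] and [psi] has compact support even though [phi] may not, so its partial
    derivative has integral zero over the whole space. Both integrands vanish off the support of
    [psi], which makes integrals over [U] and over the whole space agree. *)
Lemma test_function_integration_by_parts U phi psi i :
  smooth phi -> test_function U psi ->
  \int[mu]_(x in U) (phi x * partial i psi x) =
  - \int[mu]_(x in U) (partial i phi x * psi x).
Proof.
move=> sphi [spsi cpsi psiU].
have nU x : ~ U x -> ~ supp psi x by move=> + /psiU.
rewrite [LHS]Rintegral_zero_outside; last first.
  by move=> x /nU/supp_partial_eq0 ->; rewrite mulr0.
rewrite [X in - X]Rintegral_zero_outside; last first.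
  by move=> x /nU/supp_eq0 ->; rewrite mulr0.
have c1 : continuous (phi \* partial i psi).
  by apply: continuous_mul; [exact: smooth_continuous|
                             exact: smooth_continuous_partial].
have c2 : continuous (partial i phi \* psi).
  by apply: continuous_mul; [exact: smooth_continuous_partial|
                             exact: smooth_continuous].
have i1 : mu.-integrable setT (EFin \o (phi \* partial i psi)).
  apply: (continuous_compact_support_integrable cpsi c1) => x /supp_partial_eq0.
  by move=> /= ->; rewrite mulr0.
have i2 : mu.-integrable setT (EFin \o (partial i phi \* psi)).
  apply: (continuous_compact_support_integrable cpsi c2) => x /supp_eq0.
  by move=> /= ->; rewrite mulr0.
apply/eqP; rewrite -addr_eq0 -RintegralD//; apply/eqP.
have pM : partial i (phi * psi) =
    (fun x => phi x * partial i psi x + partial i phi x * psi x).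
  apply/funext => x; rewrite /partial deriveM; [|exact: smooth_derivable..].
  by rewrite [X in _ + X]mulrC.
have [M [_ psiM]] := compact_bounded cpsi.
transitivity (\int[mu]_x (partial i (phi * psi) x)); first by rewrite pM.
rewrite /Rintegral (@integral_partial _ _ _ _ (M + 1))//.
- by apply: continuous_mul; exact: smooth_continuous.
- by move=> x; apply: derivableM; exact: smooth_derivable.
- by rewrite pM => x; exact: cvgD (c1 x) (c2 x).
- move=> x Mx; rewrite /= -[LHS]/(phi x * psi x) (@supp_eq0 psi) ?mulr0//.
  move=> Kx; have : `|x| <= M + 1 by apply: (psiM (M + 1)) => //; rewrite ltrDl.
  by rewrite leNgt Mx.
Qed.

Lemma continuous_loc_integrable U f :
  open U -> {in U, continuous f} -> loc_integrable U f.
Proof.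
move=> oU cf; split; first exact: rV_continuous_measurable.
move=> K cK KU; have mK := rV_compact_measurable cK.
have [C fC] : exists C, forall x, K x -> `|f x| <= C.
  by apply: continuous_compact_bounded => // x /set_mem/KU/mem_set; exact: cf.
apply: measurable_bounded_integrable => //.
- exact: rV_compact_finite.
- apply: (measurable_funS (rV_open_measurable oU) KU).
  exact: rV_continuous_measurable.
- exists C; split; first exact: num_real.
  by move=> M CM x Kx /=; apply: (le_trans (fC x Kx)); exact: ltW.
Qed.

Lemma smooth_weak_gradient U phi : open U -> smooth phi ->
  weak_gradient U phi (grad phi).
Proof.
move=> oU sphi; split.
- by apply: continuous_loc_integrable => // x _; exact: smooth_continuous.
- move=> i; rewrite (_ : (fun _ => _) = partial i phi); last first.
    by apply/funext => x; rewrite mxE.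
  by apply: continuous_loc_integrable => // x _; exact: smooth_continuous_partial.
- move=> psi tpsi i; rewrite (test_function_integration_by_parts i sphi tpsi).
  by congr (- _); apply: eq_Rintegral => x _; rewrite mxE.
Qed.

Lemma loc_integrableS U V f : open U -> open V -> U `<=` V ->
  loc_integrable V f -> loc_integrable U f.
Proof.
move=> oU oV UV [mf fi]; split.
  exact: measurable_funS (rV_open_measurable oV) UV mf.
by move=> K cK KU; apply: fi => //; exact: subset_trans KU UV.
Qed.

Lemma loc_integrableD U f g : loc_integrable U f -> loc_integrable U g ->
  loc_integrable U (f \+ g).
Proof.
move=> [mf fi] [mg gi]; split; first exact: measurable_funD.
move=> K cK KU; have mK := rV_compact_measurable cK.
rewrite (_ : _ \o _ = (EFin \o f) \+ (EFin \o g))%E; last exact/funext.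
by apply: integrableD => //; [exact: fi|exact: gi].
Qed.

(** The factor [g] is bounded and confines the product to [K], where [f] is integrable. This is what
    permits splitting integrals of sums against a test function or its derivatives. *)
Lemma loc_integrable_mul_integrable U K f g : open U -> compact K -> K `<=` U ->
  loc_integrable U f -> continuous g -> (forall x, ~ K x -> g x = 0) ->
  mu.-integrable U (EFin \o (f \* g)).
Proof.
move=> oU cK KU [mf fi] cg g0; have mK := rV_compact_measurable cK.
have mU := rV_open_measurable oU.
have [C gC] : exists C, forall x, K x -> `|g x| <= C.
  by apply: continuous_compact_bounded => // x _; exact: cg.
have : mu.-integrable K (EFin \o (f \* g)).
  rewrite (_ : _ \o _ = (EFin \o f) \* (EFin \o g))%E; last exact/funext.
  apply: integrableMl => //; first exact: fi.
    exact: rV_continuous_measurableTS.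
  exists C; split; first exact: num_real.
  by move=> M CM x Kx /=; apply: (le_trans (gC x Kx)); exact: ltW.
move=> /(integrable_mkcond _ mK) h; apply/(integrable_mkcond _ mU).
apply: eq_integrable h => // x _; rewrite !patchE.
case: ifPn => [/set_mem/KU/mem_set ->//|]; rewrite notin_setE => /g0 gx.
by case: ifPn => //=; rewrite gx mulr0.
Qed.

Lemma weak_gradientD U u phi G H : open U ->
  weak_gradient U u G -> weak_gradient U phi H ->
  weak_gradient U (u \+ phi) (fun x => G x + H x).
Proof.
move=> oU [lu lG uG] [lphi lH phiH]; have mU := rV_open_measurable oU.
have E i : (fun x => (G x + H x) ord0 i) =
    (fun x => G x ord0 i) \+ (fun x => H x ord0 i).
  by apply/funext => x; rewrite mxE.
split.
- exact: loc_integrableD.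
- by move=> i; rewrite E; apply: loc_integrableD.
- move=> psi tpsi i; have [spsi cpsi psiU] := tpsi.
  have ii f : loc_integrable U f -> mu.-integrable U (EFin \o (f \* psi)).
    move=> lf; apply: (loc_integrable_mul_integrable oU cpsi) => //.
      exact: smooth_continuous.
    exact: supp_eq0.
  have di f : loc_integrable U f -> mu.-integrable U (EFin \o (f \* partial i psi)).
    move=> lf; apply: (loc_integrable_mul_integrable oU cpsi) => //.
      exact: smooth_continuous_partial.
    by move=> x; exact: supp_partial_eq0.
  transitivity (\int[mu]_(x in U) (u x * partial i psi x + phi x * partial i psi x)).
    by apply: eq_Rintegral => x _ /=; rewrite mulrDl.
  rewrite (RintegralD mU (di _ lu) (di _ lphi)) uG// phiH// -opprD.
  congr (- _); rewrite -(RintegralD mU (ii _ (lG i)) (ii _ (lH i))).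
  by apply: eq_Rintegral => x _ /=; rewrite mxE mulrDl.
Qed.

End test_functions.

(** * Test functions as admissible perturbations *)

Section test_minimality.
Context {R : realType} {N : nat}.
Implicit Types (U V K Omega : set 'rV[R]_N) (f g u phi psi : 'rV[R]_N -> R)
  (G H : 'rV[R]_N -> 'rV[R]_N).

Local Notation mu := (@lebesgue_rV R N).

Lemma continuous_compact_support_in_Lp U K f (p : R) : 1 <= p -> measurable U ->
  compact K -> continuous f -> (forall x, ~ K x -> f x = 0) -> in_Lp U p f.
Proof.
move=> p1 mU cK cf f0; have p0 : 0 < p by rewrite (lt_le_trans ltr01).
have [C fC] := continuous_compact_bounded cK (in1W cf).
have mf : measurable_fun setT (f \_ U).
  apply/(measurable_restrictT _ mU); exact: rV_continuous_measurableTS.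
rewrite /in_Lp inE; apply/andP; split; rewrite inE//=.
rewrite /finite_norm unlock poweR_lty//.
have : mu.-integrable setT (EFin \o (fun x => `|(f \_ U) x| `^ p)).
  apply: (@compact_support_integrable _ _ K _ (`|C| `^ p)) => //.
  - apply: (measurableT_comp (measurable_powR _)) => //.
    exact: measurableT_comp.
  - move=> x; rewrite ger0_norm ?powR_ge0//.
    apply: ge0_ler_powR; rewrite ?nnegrE// ?(ltW p0)//.
    rewrite patchE; case: ifPn => _; last by rewrite normr0.
    have [Kx|nKx] := pselect (K x).
      exact: le_trans (fC x Kx) (ler_norm _).
    by rewrite f0// normr0.
  - move=> x nKx; rewrite patchE; case: ifPn => _; rewrite ?f0//.
      by rewrite normr0 powR0// gt_eqF.
    by rewrite normr0 powR0// gt_eqF.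
move=> /integrableP[_]; apply: le_lt_trans.
by under [leRHS]eq_integral do rewrite /= ger0_norm ?powR_ge0//.
Qed.

(** The constant sequence [phi] serves as the approximating sequence. *)
Lemma test_function_in_W1p0 U phi (p : R) : 1 <= p -> open U ->
  test_function U phi -> in_W1p0 U p phi.
Proof.
move=> p1 oU tphi; have [sphi cphi phiU] := tphi.
have mU := rV_open_measurable oU.
have Lp f : continuous f -> (forall x, ~ supp phi x -> f x = 0) -> in_Lp U p f.
  exact: continuous_compact_support_in_Lp.
have gradE i : (fun x => grad phi x ord0 i) = partial i phi.
  by apply/funext => x; rewrite mxE.
have cvg0 f : cvg_Lp U p (fun=> f) f.
  rewrite /cvg_Lp (_ : (fun _ => _) = cst 0%E); first exact: cvg_cst.
  apply/funext => k /=; rewrite (_ : _ \o _ = cst 0%E).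
    by rewrite Lnorm0// eqe gt_eqF// (lt_le_trans ltr01).
  by apply/funext => x /=; rewrite patchE; case: ifP => //= _; rewrite subrr.
split.
- by apply: Lp; [exact: smooth_continuous|exact: supp_eq0].
- by move=> x nUx; apply: supp_eq0 => /phiU.
- exists (grad phi); split.
  + exact: smooth_weak_gradient.
  + move=> i; rewrite gradE; apply: Lp; first exact: smooth_continuous_partial.
    by move=> x; exact: supp_partial_eq0.
  + exists (fun=> phi); split => // i.
    by rewrite gradE; exact: cvg0.
Qed.

(** By compactness a single radius [e] works for all points of [K]: their [e]-balls lie in [Omega].
    The set [V] is the union of the [e / 2]-balls, so that its closure still lies in the union of
    the [e]-balls. *)
Lemma compact_open_thickening Omega K : open Omega -> compact K -> K `<=` Omega ->
  exists V, [/\ open V, compact (closure V), closure V `<=` Omega & K `<=` V].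
Proof.
move=> oO cK KO.
have /compact_near_coveringP nK := cK.
have : \forall e \near 0^'+, K `<=` (fun x => ball x (e : R) `<=` Omega).
  apply: nK => x Kx.
  have /nbhs_ballP[d /= d0 xd] : nbhs x Omega by apply: open_nbhs_nbhs; split => //; exact: KO.
  near=> y e.
  have xy : ball x (d / 2) y.
    by near: y; apply: nbhsx_ballx; rewrite divr_gt0.
  have ed : e <= d / 2 by near: e; apply: nbhs_right_le; rewrite divr_gt0.
  move=> z yz; apply: xd; rewrite (splitr d).
  exact: ball_triangle xy (le_ball ed yz).
move=> [e0 /= e00 he0].
(* [he0] covers only radii strictly below [e0]. *)
pose e := e0 / 2; have e_gt0 : 0 < e by rewrite divr_gt0.
have ee : K `<=` (fun x => ball x e `<=` Omega).
  apply: he0 => //=; rewrite sub0r normrN gtr0_norm// /e; lra.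
pose V := \bigcup_(x in K) ball x (e / 2).
have clV : closure V `<=` \bigcup_(x in K) ball x e.
  move=> y /(_ (ball y (e / 2))) [|z [[x Kx xz] yz]].
    by apply: nbhsx_ballx; rewrite divr_gt0.
  exists x => //; rewrite (splitr e); apply: (ball_triangle xz).
  exact: ball_sym.
exists V; split.
- by apply: bigcup_open => x _; exact: ball_open.
- apply: bounded_closed_compact; last exact: closed_closure.
  have [M [_ KM]] := compact_bounded cK.
  exists (M + 1 + e); split; first exact: num_real.
  move=> C MC y /clV[x Kx]; rewrite -ball_normE /= => xy.
  apply: (le_trans _ (ltW MC)).
  have xM : `|x| <= M + 1 by apply: (KM (M + 1)) => //; rewrite ltrDl.
  apply: (@le_trans _ _ (`|x| + `|x - y|)); last exact: lerD xM (ltW xy).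
  by rewrite -{1}(subKr x y); exact: ler_normB.
- by move=> y /clV[x Kx]; exact: ee.
- by move=> x Kx; exists x => //; apply: ballxx; rewrite divr_gt0.
Unshelve. all: by end_near. Qed.

(** The form of minimality from which the equation is derived. The gradients are fixed as [G] and
    [G] plus the classical gradient of [phi], which makes the property easy to carry over to another
    representative of [u] and to its opposite. *)
Definition test_minimizer Omega (p gamma lambdap lambdam : R) u G :=
  forall phi, test_function Omega phi ->
  (functionalJ Omega p gamma lambdap lambdam u G <=
   functionalJ Omega p gamma lambdap lambdam (u \+ phi)%R
     (fun x => G x + grad phi x)%R)%E.

Lemma local_minimizer_test Omega (p gamma lambdap lambdam : R) u G :
  1 <= p -> open Omega -> weak_gradient Omega u G ->
  local_minimizer Omega p gamma lambdap lambdam u ->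
  test_minimizer Omega p gamma lambdap lambdam u G.
Proof.
move=> p1 oO uG umin phi tphi; have [sphi cphi phiO] := tphi.
(* W^{1,p}_0(V) requires approximants supported in V, so V = {phi != 0} would
   be too small. *)
have [V [oV cV VO phiV]] := compact_open_thickening oO cphi phiO.
apply: (umin V) => //.
  by apply: test_function_in_W1p0 => //; split.
by apply: weak_gradientD => //; exact: smooth_weak_gradient.
Qed.

End test_minimality.

(** * Powers and the Euclidean norm *)

Section powers.
Context {R : realType}.
Implicit Types a b s p gamma : R.

(** The power is monotone in one direction or the other according to the sign of [r], so one
    endpoint always dominates. The sum of both avoids a case distinction for the exponent
    [gamma - 1]. *)
Lemma powR_le_add a b s r : 0 < a -> a <= s <= b -> s `^ r <= a `^ r + b `^ r.
Proof.
move=> a0 /andP[as_ sb]; have s0 : 0 < s by exact: lt_le_trans as_.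
have b0 : 0 < b by exact: lt_le_trans sb.
have [r0|r0] := leP 0 r.
  by rewrite ler_wpDl ?powR_ge0// ge0_ler_powR// nnegrE ltW.
rewrite ler_wpDr ?powR_ge0// -[r]opprK !(powRN _ (- r)).
by rewrite lef_pV2 ?posrE ?powR_gt0// ge0_ler_powR// ?oppr_ge0 ?nnegrE ltW.
Qed.

(** Lowers the exponents [p - 1] and [gamma] to integrability of the power [p]; the constant 1 is
    integrable on sets of finite measure. *)
Lemma powR_le1D a r s : 0 <= a -> 0 <= r <= s -> a `^ r <= 1 + a `^ s.
Proof.
move=> a0 /andP[r0 rs]; have [a1|a1] := leP a 1.
  rewrite ler_wpDr ?powR_ge0//.
  have : a `^ r <= 1 `^ r by rewrite ge0_ler_powR// nnegrE.
  by rewrite powR1.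
by rewrite ler_wpDl// ler_powR// ltW.
Qed.

Lemma powR_addr_le a b p : 0 <= a -> 0 <= b -> 0 <= p ->
  (a + b) `^ p <= 2 `^ p * (a `^ p + b `^ p).
Proof.
move=> a0 b0 p0.
have max0 : 0 <= Num.max a b by rewrite le_max a0.
apply: (@le_trans _ _ ((2 * Num.max a b) `^ p)).
  rewrite ge0_ler_powR ?nnegrE ?addr_ge0 ?mulr_ge0//.
  by rewrite mulr_natl mulr2n lerD// le_max lexx ?orbT.
rewrite powRM// ler_wpM2l ?powR_ge0//.
by rewrite /Num.max; case: ifP => _; rewrite ?lerDl ?lerDr powR_ge0.
Qed.

Lemma continuous_powR s r : 0 < s -> {for s, continuous (@powR R ^~ r)}.
Proof.
move=> s0; apply: differentiable_continuous; apply/derivable1_diffP.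
by apply: derivable_powR; rewrite in_itv/= s0.
Qed.

(** Continuity of the power at 0, beyond the reach of [continuous_powR]; the threshold for [x n] is
    [e] to the power [r^-1]. *)
Lemma cvg_powR0 (x : nat -> R) r : 0 < r -> (forall n, 0 <= x n) ->
  x n @[n --> \oo] --> 0 -> x n `^ r @[n --> \oo] --> 0.
Proof.
move=> r0 x0 cx; apply/cvgrPdist_lt => e e0.
have er : 0 < e `^ r^-1 by rewrite powR_gt0.
near=> n; rewrite sub0r normrN ger0_norm ?powR_ge0//.
have -> : e = (e `^ r^-1) `^ r by rewrite -powRrM mulVf ?gt_eqF// powRr1// ltW.
apply: gt0_ltr_powR => //; rewrite ?nnegrE ?x0 ?(ltW er)//.
rewrite -[ltLHS]ger0_norm// -[X in `|X|]subr0.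
by near: n; apply: cvgr_distC_lt.
Unshelve. all: by end_near. Qed.

Lemma powR_MVT s t gamma : 0 < s -> 0 < t -> exists xi,
  [/\ Num.min s t <= xi <= Num.max s t &
      t `^ gamma - s `^ gamma = gamma * xi `^ (gamma - 1) * (t - s)].
Proof.
have main a b : 0 < a -> a <= b -> exists xi,
    a <= xi <= b /\ b `^ gamma - a `^ gamma = gamma * xi `^ (gamma - 1) * (b - a).
  move=> a0 ab.
  have [| |xi xiab ->] := @MVT_segment R (@powR R ^~ gamma)
      (fun x => gamma * x `^ (gamma - 1)) a b ab.
  - move=> x /[!in_itv]/= /andP[ax _]; apply: is_derive1_powR.
    exact: lt_trans ax.
  - apply: continuous_in_subspaceT => x /set_mem /=; rewrite in_itv/= => /andP[ax _].
    by apply: continuous_powR; exact: lt_le_trans ax.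
  - by exists xi; split => //; move: xiab; rewrite in_itv.
move=> s0 t0; have [st|/ltW ts] := leP s t.
  by have [xi [h1 h2]] := main s t s0 st; exists xi; split.
have [xi [h1 h2]] := main t s t0 ts; exists xi; split => //.
by rewrite -opprB h2; ring.
Qed.

Lemma powR_tangent a b p : 1 < p -> 0 < a -> 0 <= b ->
  a `^ p / p <= b `^ p / p + a `^ (p - 2) * (a ^+ 2 - a * b).
Proof.
move=> p1 a0 b0; have p0 : 0 < p by rewrite (lt_trans ltr01).
have pm0 : 0 < p - 1 by rewrite subr_gt0.
have E1 : a `^ (p - 2) * a = a `^ (p - 1).
  rewrite -{2}(powRr1 (ltW a0)) -powRD; last by rewrite (gt_eqF a0) implybT.
  by congr powR; ring.
have E2 : a `^ (p - 1) * a = a `^ p.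
  rewrite -{2}(powRr1 (ltW a0)) -powRD; last by rewrite (gt_eqF a0) implybT.
  by congr powR; ring.
have E3 : (a `^ (p - 1)) `^ (p / (p - 1)) = a `^ p.
  by rewrite -powRrM; congr powR; rewrite mulrCA mulfV ?mulr1// gt_eqF.
have : b * a `^ (p - 1) <= b `^ p / p + (a `^ (p - 1)) `^ (p / (p - 1)) / (p / (p - 1)).
  apply: conjugate_powR => //; rewrite ?powR_ge0// ?divr_gt0//.
  by field; rewrite !gt_eqF.
rewrite E3 => young.
have -> : a `^ (p - 2) * (a ^+ 2 - a * b) = a `^ p - b * a `^ (p - 1).
  by rewrite -E2 -E1; ring.
have -> : a `^ p / p = a `^ p - a `^ p / (p / (p - 1)).
  by field; rewrite !gt_eqF.
lra.
Qed.

End powers.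

Section euclidean_norm.
Context {R : realType} {N : nat}.
Implicit Types (a b g h z : 'rV[R]_N) (p : R).

Lemma eucl_norm_ge0 (x : 'rV[R]_N) : 0 <= eucl_norm x.
Proof. exact: sqrtr_ge0. Qed.

Lemma eucl_norm_sqr (x : 'rV[R]_N) : eucl_norm x ^+ 2 = \sum_i x ord0 i ^+ 2.
Proof. by rewrite sqr_sqrtr// sumr_ge0// => i _; exact: sqr_ge0. Qed.

Lemma entry_le_eucl_norm (x : 'rV[R]_N) i : `|x ord0 i| <= eucl_norm x.
Proof.
rewrite -sqrtr_sqr ler_wsqrtr// (bigD1 i)//= lerDl.
by rewrite sumr_ge0// => j _; exact: sqr_ge0.
Qed.

Lemma eucl_norm_eq0 (x : 'rV[R]_N) : eucl_norm x = 0 -> x = 0.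
Proof.
move=> x0; apply/rowP => i; rewrite mxE; apply/eqP.
by rewrite -normr_le0 -x0; exact: entry_le_eucl_norm.
Qed.

Lemma eucl_norm0 : eucl_norm (0 : 'rV[R]_N) = 0.
Proof.
by rewrite /eucl_norm big1 ?sqrtr0// => i _; rewrite mxE expr0n.
Qed.

Lemma cauchy_schwarz_rV a b :
  \sum_i a ord0 i * b ord0 i <= eucl_norm a * eucl_norm b.
Proof.
have := eucl_norm_ge0 a; rewrite le_eqVlt => /predU1P[/esym/eucl_norm_eq0 ->|a0].
  by rewrite big1 ?eucl_norm0 ?mul0r// => i _; rewrite mxE mul0r.
have := eucl_norm_ge0 b; rewrite le_eqVlt => /predU1P[/esym/eucl_norm_eq0 ->|b0].
  by rewrite big1 ?eucl_norm0 ?mulr0// => i _; rewrite mxE mulr0.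
set A := eucl_norm a in a0 *; set B := eucl_norm b in b0 *.
(* The weights [B / A] and [A / B] are those for which the termwise inequality between arithmetic
   and geometric means sums exactly to [A * B]. *)
have -> : A * B = \sum_i ((B / A) * a ord0 i ^+ 2 + (A / B) * b ord0 i ^+ 2) / 2.
  rewrite -mulr_suml big_split/= -!mulr_sumr -!eucl_norm_sqr -/A -/B.
  by field; rewrite !gt_eqF.
apply: ler_sum => i _; set s := a ord0 i; set t := b ord0 i.
rewrite ler_pdivlMr// -subr_ge0.
have -> : B / A * s ^+ 2 + A / B * t ^+ 2 - s * t * 2 = (B * s - A * t) ^+ 2 / (A * B).
  by field; rewrite !gt_eqF.
by rewrite divr_ge0 ?sqr_ge0// ltW// mulr_gt0.
Qed.

Lemma eucl_normD a b : eucl_norm (a + b) <= eucl_norm a + eucl_norm b.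
Proof.
rewrite -ler_sqr ?nnegrE ?addr_ge0 ?eucl_norm_ge0//.
rewrite eucl_norm_sqr sqrrD !eucl_norm_sqr.
under eq_bigr do rewrite mxE sqrrD.
rewrite !big_split/= lerD2r lerD2l -mulr2n lerMn2r/=.
exact: cauchy_schwarz_rV.
Qed.

Lemma eucl_normZ (t : R) (x : 'rV[R]_N) : eucl_norm (t *: x) = `|t| * eucl_norm x.
Proof.
rewrite /eucl_norm -sqrtr_sqr -sqrtrM ?sqr_ge0//; congr Num.sqrt.
by rewrite mulr_sumr; apply: eq_bigr => i _; rewrite mxE exprMn.
Qed.

(** The Euclidean norm is at most [N] times the sup norm, and the sup norm is attained at an entry,
    whose power is one of the summands. This passes from components in L^p to the length of the
    vector. *)
Lemma eucl_norm_powR_le p (x : 'rV[R]_N) : 0 < p ->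
  eucl_norm x `^ p <= N%:R `^ p * \sum_i `|x ord0 i| `^ p.
Proof.
move=> p0.
(* If no entry attains the sup norm then the vector is zero; this takes care of [N = 0]. *)
have [[i xi]|nx] := pselect (exists i, `|x| = `|x ord0 i|); last first.
  have -> : x = 0.
    apply/eqP; apply: contra_notT nx => x0.
    have [|[i j] /= xij] := @mx_norm_neq0 _ _ _ x.
      by apply: contra x0 => /eqP/mx_norm_eq0 ->.
    by exists j; rewrite [LHS]xij (ord1 i).
  rewrite eucl_norm0 powR0 ?gt_eqF// mulr_ge0 ?powR_ge0// sumr_ge0//.
have xN : eucl_norm x <= N%:R * `|x|.
  have N1 : (1 : R) <= N%:R.
    by rewrite ler1n; case: N i {x xi} => // -[].
  rewrite -ler_sqr ?nnegrE ?mulr_ge0 ?eucl_norm_ge0//.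
  rewrite eucl_norm_sqr; apply: (@le_trans _ _ (\sum_(i < N) `|x| ^+ 2)).
    apply: ler_sum => j _; rewrite -real_normK ?num_real//.
    by rewrite ler_sqr ?nnegrE//; exact: rV_entry_le_norm.
  rewrite sumr_const card_ord exprMn -[leLHS]mulr_natl ler_wpM2r ?sqr_ge0//.
  by rewrite expr2 ler_peMl// (le_trans ler01).
apply: (@le_trans _ _ ((N%:R * `|x|) `^ p)).
  by rewrite ge0_ler_powR// ?nnegrE ?mulr_ge0 ?eucl_norm_ge0// ltW.
rewrite powRM// ler_wpM2l ?powR_ge0// xi (bigD1 i)//= lerDl.
by rewrite sumr_ge0// => j _; exact: powR_ge0.
Qed.

(** The [i]-th partial derivative of |z|^p / p. It vanishes at [z = 0] for every [p], thanks to the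
    factor [z ord0 i]. *)
Definition p_flux p z i : R := eucl_norm z `^ (p - 2) * z ord0 i.

Lemma p_flux_le p z i : 1 < p -> `|p_flux p z i| <= eucl_norm z `^ (p - 1).
Proof.
move=> p1; rewrite /p_flux normrM ger0_norm ?powR_ge0//.
have := eucl_norm_ge0 z; rewrite le_eqVlt => /predU1P[/esym z0|z0].
  by rewrite (eucl_norm_eq0 z0) mxE normr0 mulr0 powR_ge0.
apply: (@le_trans _ _ (eucl_norm z `^ (p - 2) * eucl_norm z)).
  by rewrite ler_wpM2l ?powR_ge0// entry_le_eucl_norm.
rewrite -{2}(powRr1 (ltW z0)) -powRD; last by rewrite (gt_eqF z0) implybT.
by rewrite (_ : p - 2 + 1 = p - 1)//; ring.
Qed.

(** The scalar inequality [powR_tangent] for the two lengths, followed by Cauchy-Schwarz. The slope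
    is taken at [z], the vector whose energy is bounded from above; at [z = 0] the left side and the
    flux vanish. *)
Lemma eucl_norm_powR_tangent p g z : 1 < p ->
  eucl_norm z `^ p / p <=
  eucl_norm g `^ p / p + \sum_i p_flux p z i * (z ord0 i - g ord0 i).
Proof.
move=> p1; have p0 : 0 < p by rewrite (lt_trans ltr01).
have := eucl_norm_ge0 z; rewrite le_eqVlt => /predU1P[/esym z0|z0].
  rewrite z0 powR0 ?gt_eqF// mul0r big1.
    by rewrite addr0 divr_ge0 ?powR_ge0 ?ltW.
  by move=> i _; rewrite /p_flux (eucl_norm_eq0 z0) mxE mulr0 mul0r.
apply: (le_trans (powR_tangent p1 z0 (eucl_norm_ge0 g))).
rewrite lerD2l /p_flux.
under [leRHS]eq_bigr do rewrite -mulrA.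
rewrite -mulr_sumr ler_wpM2l ?powR_ge0//.
under eq_bigr do rewrite mulrBr -expr2.
rewrite sumrB eucl_norm_sqr lerD2l lerN2.
exact: cauchy_schwarz_rV.
Qed.

(** Away from [g = 0] both factors of the flux converge. At [g = 0] the factor with exponent [p - 2]
    may blow up, and the flux is squeezed by the power [p - 1 > 0] of the length instead. *)
Lemma p_flux_cvg p g h (t : nat -> R) i : 1 < p -> t n @[n --> \oo] --> 0 ->
  p_flux p (g + t n *: h) i @[n --> \oo] --> p_flux p g i.
Proof.
move=> p1 t0.
have th0 : `|t n| * eucl_norm h @[n --> \oo] --> 0.
  rewrite -(mul0r (eucl_norm h)); apply: cvgM; last exact: cvg_cst.
  by rewrite -(normr0 R); exact: cvg_norm.
have nc : eucl_norm (g + t n *: h) @[n --> \oo] --> eucl_norm g.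
  apply/cvgrPdist_le => e e0; near=> n.
  apply: (@le_trans _ _ (`|t n| * eucl_norm h)).
    have h1 := eucl_normD g (t n *: h).
    have h2 := eucl_normD (g + t n *: h) (- t n *: h).
    rewrite scaleNr addrK -scaleNr in h2.
    rewrite !eucl_normZ normrN in h1 h2.
    rewrite ler_norml; apply/andP; split; lra.
  rewrite -[leLHS]ger0_norm ?mulr_ge0 ?eucl_norm_ge0// -[X in `|X|]subr0.
  by near: n; apply: cvgr_distC_le.
have := eucl_norm_ge0 g; rewrite le_eqVlt => /predU1P[/esym g0|g0]; last first.
  have c1 : eucl_norm (g + t n *: h) `^ (p - 2) @[n --> \oo] -->
      eucl_norm g `^ (p - 2).
    apply: (@continuous_cvg _ _ _ _ _ _ (fun x : R => x `^ (p - 2))) => //.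
    exact: continuous_powR.
  have c2 : (g + t n *: h) ord0 i @[n --> \oo] --> g ord0 i.
    rewrite (_ : (fun _ => _) = (fun n => g ord0 i + t n * h ord0 i)); last first.
      by apply/funext => n; rewrite 2!mxE.
    rewrite -[X in _ --> X]addr0; apply: cvgD; first exact: cvg_cst.
    by rewrite -(mul0r (h ord0 i)); apply: cvgM => //; exact: cvg_cst.
  exact: cvgM c1 c2.
rewrite (_ : p_flux p g i = 0); last first.
  by rewrite /p_flux (eucl_norm_eq0 g0) mxE mulr0.
apply/norm_cvg0P.
apply: (@squeeze_cvgr _ _ _ _ (fun=> 0) (fun n => eucl_norm (g + t n *: h) `^ (p - 1))).
- by apply: nearW => n; rewrite normr_ge0/= p_flux_le.
- exact: cvg_cst.
- apply: cvg_powR0; first by rewrite subr_gt0.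
    by move=> n; exact: eucl_norm_ge0.
  by rewrite -g0.
Unshelve. all: by end_near. Qed.

Lemma measurable_eucl_norm d (T : measurableType d) (D : set T)
    (G : T -> 'rV[R]_N) : (forall i, measurable_fun D (fun x => G x ord0 i)) ->
  measurable_fun D (fun x => eucl_norm (G x)).
Proof.
move=> mG.
have msqrt : measurable_fun [set: R] (@Num.sqrt R).
  by apply: continuous_measurable_fun; exact: sqrt_continuous.
have msum : measurable_fun D (fun x => \sum_i G x ord0 i ^+ 2).
  by apply: measurable_sum => i; apply: measurable_funX; exact: mG.
exact: (measurableT_comp msqrt msum).
Qed.

Lemma measurable_p_flux d (T : measurableType d) (D : set T)
    (G : T -> 'rV[R]_N) p i : (forall i, measurable_fun D (fun x => G x ord0 i)) ->
  measurable_fun D (fun x => p_flux p (G x) i).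
Proof.
move=> mG; apply: measurable_funM; last exact: mG.
apply: (measurableT_comp (measurable_powR _)).
exact: measurable_eucl_norm.
Qed.

End euclidean_norm.

(** * The first variation *)

Section potential.
Context {R : realType}.
Implicit Types s x y gamma lambdap lambdam : R.

Lemma Fgamma_pos gamma lambdap lambdam s : 0 < gamma -> 0 < s ->
  Fgamma gamma lambdap lambdam s = lambdap * s `^ gamma.
Proof.
move=> g0 s0; rewrite /Fgamma (max_l (ltW s0)) max_r ?oppr_le0 ?ltW//.
by rewrite powR0 ?gt_eqF// mulr0 addr0.
Qed.

Lemma Fgamma_ge0 gamma lambdap lambdam s : 0 <= lambdap -> 0 <= lambdam ->
  0 <= Fgamma gamma lambdap lambdam s.
Proof. by move=> l0 m0; rewrite addr_ge0// mulr_ge0// powR_ge0. Qed.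

Lemma measurable_Fgamma gamma lambdap lambdam :
  measurable_fun [set: R] (Fgamma gamma lambdap lambdam).
Proof.
apply: measurable_funD; apply: measurable_funM => //.
  apply: (measurableT_comp (measurable_powR _)).
  by apply: measurable_maxr.
apply: (measurableT_comp (measurable_powR _)).
by apply: measurable_maxr => //; exact: measurable_oppr.
Qed.

(** The bound [s / 2] keeps [s + x] positive, so only the branch with [lambdap] is active and the
    mean value theorem for the power applies between [s] and [s + x]. *)
Lemma Fgamma_MVT gamma lambdap lambdam s x : 0 < gamma -> 0 < s ->
  `|x| <= s / 2 -> exists xi, `|xi - s| <= `|x| /\
  Fgamma gamma lambdap lambdam (s + x) - Fgamma gamma lambdap lambdam s =
  gamma * lambdap * xi `^ (gamma - 1) * x.
Proof.
move=> g0 s0 xs; have sx0 : 0 < s + x by move: xs; rewrite ler_norml; lra.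
have [xi [/andP[h1 h2] h3]] := powR_MVT gamma s0 sx0.
exists xi; split.
  move: h1 h2; rewrite /Num.min /Num.max; case: ifPn => h h1 h2.
    by rewrite ger0_norm ?subr_ge0// (le_trans _ (ler_norm x)); lra.
  rewrite -leNgt in h.
  rewrite ler0_norm ?subr_le0// -normrN (le_trans _ (ler_norm _)); lra.
rewrite !Fgamma_pos// -mulrBr h3; ring.
Qed.

Lemma Fgamma_quotient_cvg gamma lambdap lambdam s x (t : nat -> R) :
  0 < gamma -> 0 < s -> (forall n, 0 < t n) -> (forall n, `|t n * x| <= s / 2) ->
  t n @[n --> \oo] --> 0 ->
  (Fgamma gamma lambdap lambdam (s + t n * x) - Fgamma gamma lambdap lambdam s) / t n
    @[n --> \oo] --> gamma * lambdap * s `^ (gamma - 1) * x.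
Proof.
move=> g0 s0 t0 tx ct.
have [xi hxi] := choice (fun n => Fgamma_MVT lambdap lambdam g0 s0 (tx n)).
rewrite (_ : (fun _ => _) = fun n => gamma * lambdap * xi n `^ (gamma - 1) * x); last first.
  apply/funext => n; rewrite (hxi n).2; field.
  by rewrite gt_eqF.
have cxi : xi n @[n --> \oo] --> s.
  apply/cvgrPdist_le => e e0; near=> n.
  rewrite distrC; apply: (le_trans (hxi n).1).
  rewrite -[X in `|X|]subr0; near: n.
  have : t n * x @[n --> \oo] --> 0.
    by rewrite -(mul0r x); apply: cvgM => //; exact: cvg_cst.
  by move=> /cvgr_distC_le; exact.
apply: cvgM; last exact: cvg_cst.
apply: cvgM; first exact: cvg_cst.
apply: (@continuous_cvg _ _ _ _ _ _ (fun y : R => y `^ (gamma - 1))) => //.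
exact: continuous_powR.
Unshelve. all: by end_near. Qed.

(** The intermediate point stays between [m / 2] and [M + m / 2]; since [gamma - 1] can have either
    sign, the powers of both ends appear. The bound does not depend on [t], as domination
    requires. *)
Lemma Fgamma_quotient_le gamma lambdap lambdam (m M s x t : R) :
  0 < gamma -> 0 <= lambdap -> 0 < m -> m <= s <= M -> 0 < t ->
  `|t * x| <= m / 2 ->
  `|(Fgamma gamma lambdap lambdam (s + t * x) - Fgamma gamma lambdap lambdam s) / t|
  <= gamma * lambdap * ((m / 2) `^ (gamma - 1) + (M + m / 2) `^ (gamma - 1)) * `|x|.
Proof.
move=> g0 l0 m0 /andP[ms sM] t0 tx; have s0 : 0 < s by exact: lt_le_trans ms.
have [xi [h1 ->]] : exists xi, `|xi - s| <= `|t * x| /\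
    Fgamma gamma lambdap lambdam (s + t * x) - Fgamma gamma lambdap lambdam s =
    gamma * lambdap * xi `^ (gamma - 1) * (t * x).
  by apply: Fgamma_MVT => //; lra.
rewrite (_ : _ / t = gamma * lambdap * xi `^ (gamma - 1) * x); last first.
  by field; rewrite gt_eqF.
rewrite normrM ler_wpM2r// normrM (ger0_norm (powR_ge0 _ _)).
rewrite ger0_norm ?mulr_ge0 ?(ltW g0)// ler_wpM2l ?mulr_ge0 ?(ltW g0)//.
apply: powR_le_add; first lra.
have := le_trans h1 tx; rewrite ler_norml; lra.
Qed.

End potential.

Section first_variation.
Context {R : realType} {N : nat}.
Implicit Types (Omega K : set 'rV[R]_N) (v phi : 'rV[R]_N -> R)
  (G : 'rV[R]_N -> 'rV[R]_N) (p gamma lambdap lambdam : R).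

Local Notation mu := (@lebesgue_rV R N).

Lemma cvg_sum (I : finType) (T : Type) (F : set_system T) (f : I -> T -> R)
    (l : I -> R) : Filter F -> (forall i, f i x @[x --> F] --> l i) ->
  \sum_i f i x @[x --> F] --> \sum_i l i.
Proof.
move=> FF fl; apply: cvg_big => [|i _]; last exact: fl.
exact: add_continuous.
Qed.

Lemma test_function_bounds phi : smooth phi -> compact (supp phi) ->
  exists C, 0 <= C /\ forall x, [/\ `|phi x| <= C,
    forall i, `|partial i phi x| <= C & eucl_norm (grad phi x) <= C].
Proof.
move=> sphi cphi.
pose g x := `|phi x| + \sum_i `|partial i phi x|.
have cg : continuous g.
  have cn (f : 'rV[R]_N -> R) : continuous f -> continuous (fun x => `|f x|).
    move=> cf x; apply: continuous_comp; first exact: cf.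
    exact: norm_continuous.
  move=> x; apply: (@cvgD _ _ _ (nbhs x) _ (fun x => `|phi x|)
      (fun x => \sum_i `|partial i phi x|)).
    exact: (cn _ (smooth_continuous sphi)).
  apply: (@cvg_sum _ _ (nbhs x) (fun i x => `|partial i phi x|) (fun i => `|partial i phi x|)) => i.
  exact: (cn _ (smooth_continuous_partial (i := i) sphi)).
have [C gC] := continuous_compact_bounded cphi (in1W cg).
have gC1 x : g x <= `|C|.
  have [Kx|nKx] := pselect (supp phi x).
    by rewrite (le_trans (ler_norm _))// (le_trans (gC x Kx))// ler_norm.
  rewrite /g supp_eq0// normr0 add0r big1// => i _.
  by rewrite supp_partial_eq0// normr0.
have pg i x : `|partial i phi x| <= g x.
  rewrite /g (bigD1 i)//= addrCA lerDl addr_ge0// sumr_ge0//.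
have nC1 : 0 <= N%:R * (\sum_(i < N) `|C|) by rewrite mulr_ge0// sumr_ge0.
(* The first term bounds [phi] and its partial derivatives, the second the length of the gradient
   through [eucl_norm_powR_le] with exponent 1. *)
exists (`|C| + N%:R * (\sum_(i < N) `|C|)); split; first by rewrite addr_ge0.
move=> x; split.
- rewrite (@le_trans _ _ `|C|) ?lerDl// (le_trans _ (gC1 x))// lerDl.
  by rewrite sumr_ge0.
- by move=> i; rewrite (@le_trans _ _ `|C|) ?lerDl// (le_trans _ (gC1 x)).
- apply: (@le_trans _ _ (N%:R * (\sum_(i < N) `|C|))); last by rewrite lerDr.
  have := eucl_norm_powR_le (grad phi x) (@ltr01 R).
  rewrite !powRr1 ?eucl_norm_ge0//; move=> /le_trans; apply.
  rewrite ler_wpM2l//; apply: ler_sum => i _; rewrite powRr1// mxE.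
  exact: le_trans (pg i x) (gC1 x).
Qed.

(** The one-sided Euler-Lagrange inequality. Integrability of [w] belongs to the conclusion because
    comparing [phi] with its opposite uses linearity of the integral. *)
Lemma first_variation_ge0 Omega p gamma lambdap lambdam v G phi :
  open Omega -> (mu Omega < +oo)%E -> 1 < p -> 0 < gamma ->
  0 <= lambdap -> 0 <= lambdam -> {in Omega, continuous v} ->
  (forall i, measurable_fun Omega (fun x => G x ord0 i)) ->
  mu.-integrable Omega (EFin \o (fun x => eucl_norm (G x) `^ p)) ->
  mu.-integrable Omega (EFin \o (fun x => eucl_norm (G x) `^ p / p +
    Fgamma gamma lambdap lambdam (v x))) ->
  test_minimizer Omega p gamma lambdap lambdam v G ->
  test_function ([set x | 0 < v x] `&` Omega) phi ->
  let w x := \sum_i p_flux p (G x) i * partial i phi x +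
             gamma * lambdap * v x `^ (gamma - 1) * phi x in
  mu.-integrable Omega (EFin \o w) /\ 0 <= \int[mu]_(x in Omega) w x.
Proof.
move=> oO fO p1 g0 lp0 lm0 cv mG iG iJ vmin tphi w.
have mO := rV_open_measurable oO.
have p0 : 0 < p by exact: lt_trans p1.
have mv : measurable_fun Omega v by exact: rV_continuous_measurable.
have [sphi cphi phiU] := tphi.
pose K := supp phi.
have KO : K `<=` Omega by move=> x /phiU[].
have Kv x : K x -> 0 < v x by move=> /phiU[].
have [C [C0 phiC]] := test_function_bounds sphi cphi.
have [M vM] : exists M, forall x, K x -> `|v x| <= M.
  apply: continuous_compact_bounded => // x /set_mem/KO/mem_set; exact: cv.
(* The lower bound comes from boundedness of [(v x)^-1] on [K]; adding 1 keeps the inverse positive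
   even when [B] is 0. *)
have [m m0 vm] : exists2 m, 0 < m & forall x, K x -> m <= v x.
  have [B vB] : exists B, forall x, K x -> `|(v x)^-1| <= B.
    apply: continuous_compact_bounded => // x /set_mem Kx.
    have vx0 : v x != 0 by rewrite gt_eqF// Kv.
    exact: (cvgV vx0 (cv x (mem_set (KO _ Kx)))).
  exists (`|B| + 1)^-1; first by rewrite invr_gt0 ltr_wpDl.
  move=> x Kx; have v0 := Kv x Kx.
  rewrite -[leRHS]invrK lef_pV2 ?posrE ?invr_gt0 ?ltr_wpDl//.
  have := vB x Kx; rewrite ger0_norm ?invr_ge0 ?(ltW v0)// => h.
  by rewrite (le_trans h)// (le_trans (ler_norm B))// lerDl.
(* The second entry gives [|t phi| <= m / 2], hence positivity of [v + t phi] on [K], with [C + 1]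
   avoiding a zero denominator. The first keeps the perturbed gradient within [C] of [G]. *)
pose tau := Num.min 1 (m / 2 / (C + 1)).
have C10 : 0 < C + 1 by rewrite ltr_wpDl.
have tau0 : 0 < tau by rewrite lt_min ltr01/= !divr_gt0.
pose t n : R := tau * harmonic n.
have t0 n : 0 < t n by rewrite mulr_gt0// harmonic_gt0.
have ttau n : t n <= tau.
  by rewrite ler_piMr ?(ltW tau0)// /harmonic/= invf_le1 ?ler1n// ltr0n.
have t1 n : t n <= 1 by rewrite (le_trans (ttau n))// ge_min lexx.
have tphi2 n x : `|t n * phi x| <= m / 2.
  rewrite normrM (gtr0_norm (t0 n)).
  apply: (@le_trans _ _ (m / 2 / (C + 1) * (C + 1))); last by rewrite divfK// gt_eqF.
  apply: ler_pM => //; first exact: ltW.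
    by rewrite (le_trans (ttau n))// ge_min lexx orbT.
  by have [h _ _] := phiC x; rewrite (le_trans h)// lerDl.
have ct : t n @[n --> \oo] --> 0.
  rewrite -(mulr0 tau); apply: cvgM; first exact: cvg_cst.
  exact: cvg_harmonic.
pose F := Fgamma gamma lambdap lambdam.
(* The gradient part is the flux at the perturbed gradient, an upper bound for the difference
   quotient of the gradient energy; the second part is the exact quotient of [F]. *)
pose k n x := \sum_i p_flux p (G x + t n *: grad phi x) i * partial i phi x +
  (F (v x + t n * phi x) - F (v x)) / t n.
have k0 n x : ~ K x -> k n x = 0.
  move=> nKx; rewrite /k big1 => [|i _].
    by rewrite (supp_eq0 nKx) mulr0 addr0 subrr mul0r addr0.
  by rewrite (supp_partial_eq0 _ nKx) mulr0.
have mphi : measurable_fun Omega phi.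
  exact: rV_continuous_measurableTS (smooth_continuous sphi).
have mdphi i : measurable_fun Omega (partial i phi).
  exact: rV_continuous_measurableTS (smooth_continuous_partial sphi).
have mF := measurable_Fgamma gamma lambdap lambdam.
have mk n : measurable_fun Omega (k n).
  apply: measurable_funD.
    apply: measurable_sum => i; apply: measurable_funM => //.
    apply: measurable_p_flux => j.
    rewrite (_ : (fun _ => _) = (fun x => G x ord0 j + t n * partial j phi x)).
      by apply: measurable_funD => //; apply: measurable_funM.
    by apply/funext => x; rewrite !mxE.
  apply: measurable_funM => //; apply: measurable_funB; apply: (measurableT_comp mF) => //.
  by apply: measurable_funD => //; apply: measurable_funM.
have mw : measurable_fun Omega w.
  apply: measurable_funD.
    apply: measurable_sum => i; apply: measurable_funM => //.
    exact: measurable_p_flux.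
  apply: measurable_funM => //; apply: measurable_funM => //.
  exact: (measurableT_comp (measurable_powR _)).
(* Each flux component is at most 1 + 2^p (|G|^p + C^p) and each partial derivative at most [C]; the
   product is split into a constant and a multiple of |G|^p. The last term of [D0] is the bound of
   [Fgamma_quotient_le]. *)
pose D1 := \sum_(i < N) 2 `^ p * C.
pose D0 := \sum_(i < N) (1 + 2 `^ p * C `^ p) * C +
  gamma * lambdap * ((m / 2) `^ (gamma - 1) + (M + m / 2) `^ (gamma - 1)) * C.
pose dom x := D0 + D1 * eucl_norm (G x) `^ p.
have idom : mu.-integrable Omega (EFin \o dom).
  rewrite (_ : _ \o _ = (fun x => (D0%:E + D1%:E * (eucl_norm (G x) `^ p)%:E)%E)).
    apply: integrableD => //; first exact: finite_integrable_cst.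
    exact: integrableZl.
  exact/funext.
have D00 : 0 <= D0.
  rewrite addr_ge0//; last by rewrite !mulr_ge0 ?(ltW g0) ?addr_ge0 ?powR_ge0.
  by rewrite sumr_ge0// => i _; rewrite mulr_ge0// addr_ge0// mulr_ge0 ?powR_ge0.
have D10 : 0 <= D1 by rewrite sumr_ge0// => i _; rewrite mulr_ge0// powR_ge0.
have kdom n x : `|k n x| <= dom x.
  have [Kx|nKx] := pselect (K x); last first.
    by rewrite k0// normr0 addr_ge0// mulr_ge0// powR_ge0.
  have [c1 c2 c3] := phiC x.
  rewrite /k (le_trans (ler_normD _ _))// /dom /D0 /D1 [leRHS]addrAC lerD//.
    rewrite mulr_suml -big_split/= (le_trans (ler_norm_sum _ _ _))//.
    apply: ler_sum => i _; rewrite normrM.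
    rewrite [leRHS](_ : _ = (1 + 2 `^ p * (eucl_norm (G x) `^ p + C `^ p)) * C); last by ring.
    apply: ler_pM => //.
    apply: (le_trans (p_flux_le _ i p1)).
    set z := G x + _.
    have zC : eucl_norm z <= eucl_norm (G x) + C.
      rewrite (le_trans (eucl_normD _ _))// lerD2l eucl_normZ gtr0_norm//.
      by rewrite (le_trans _ c3)// ler_piMl// eucl_norm_ge0.
    have h : eucl_norm z `^ (p - 1) <= 1 + eucl_norm z `^ p.
      by rewrite powR_le1D ?eucl_norm_ge0//; lra.
    rewrite (le_trans h)// lerD2l.
    apply: (@le_trans _ _ ((eucl_norm (G x) + C) `^ p)).
      by rewrite ge0_ler_powR ?nnegrE ?addr_ge0 ?eucl_norm_ge0// ltW.
    by rewrite powR_addr_le ?eucl_norm_ge0// ltW.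
  apply: (@le_trans _ _ (gamma * lambdap *
      ((m / 2) `^ (gamma - 1) + (M + m / 2) `^ (gamma - 1)) * `|phi x|)).
    apply: Fgamma_quotient_le => //.
    by rewrite vm// (le_trans (ler_norm _))// vM.
  by rewrite ler_wpM2l// !mulr_ge0 ?(ltW g0) ?addr_ge0 ?powR_ge0.
have kw x : Omega x -> k n x @[n --> \oo] --> w x.
  move=> Ox; have [Kx|nKx] := pselect (K x); last first.
    rewrite (_ : (fun _ => _) = (fun=> 0)); last by apply/funext => n; exact: k0.
    rewrite (_ : w x = 0); first exact: cvg_cst.
    rewrite /w big1 => [|i _]; first by rewrite (supp_eq0 nKx) mulr0 addr0.
    by rewrite (supp_partial_eq0 _ nKx) mulr0.
  apply: cvgD.
    apply: cvg_sum => i; apply: cvgM; last exact: cvg_cst.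
    exact: p_flux_cvg.
  apply: Fgamma_quotient_cvg => //; first exact: Kv.
  by move=> n; rewrite (le_trans (tphi2 n x))// ler_pM2r// vm.
have ik n : mu.-integrable Omega (EFin \o k n).
  apply: le_integrable idom => //; first exact/measurable_EFinP.
  move=> x _ /=; rewrite lee_fin (le_trans (kdom n x))//.
  exact: ler_norm.
pose J x := eucl_norm (G x) `^ p / p + F (v x).
have mJ : measurable_fun Omega J .
  by apply/measurable_EFinP; case/integrableP: iJ.
(* J[v] <= J[v + t phi] <= J[v] + t times the integral of [k n], the second inequality holding
   pointwise for the integrands; J[v] is finite and cancels, and [t n] is positive. *)
have kge0 n : 0 <= \int[mu]_(x in Omega) k n x.
  have hJ := vmin _ (test_function_scale (t n) (test_functionS (@subIsetr _ _ _) tphi)).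
  have : (\int[mu]_(x in Omega) (J x)%:E <=
    \int[mu]_(x in Omega) (J x + t n * k n x)%:E)%E.
    apply: (le_trans hJ); rewrite /functionalJ; apply: ge0_le_integral => //.
    - move=> x _; rewrite lee_fin addr_ge0 ?Fgamma_ge0//.
      by rewrite divr_ge0 ?powR_ge0 ?ltW.
    - apply/measurable_EFinP; apply: measurable_funD.
        apply: measurable_funM => //.
        apply: (measurableT_comp (measurable_powR _)).
        apply: measurable_eucl_norm => i.
        rewrite (_ : (fun _ => _) = (fun x => G x ord0 i + t n * partial i phi x)).
          by apply: measurable_funD => //; apply: measurable_funM.
        by apply/funext => x; rewrite grad_scale// !mxE.
      apply: (measurableT_comp mF).
      by apply: measurable_funD => //; apply: measurable_funM.
    - by apply/measurable_EFinP; apply: measurable_funD => //; apply: measurable_funM.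
    - move=> x _; rewrite lee_fin grad_scale//=.
      set z := G x + t n *: grad phi x.
      rewrite /J /k -/z mulrDr [t n * (_ / t n)]mulrC divfK ?gt_eqF//.
      have -> : t n * \sum_i p_flux p z i * partial i phi x =
          \sum_i p_flux p z i * (z ord0 i - G x ord0 i).
        rewrite mulr_sumr; apply: eq_bigr => i _.
        by rewrite /z !mxE; ring.
      rewrite addrACA lerD//; first exact: eucl_norm_powR_tangent.
      by rewrite addrC subrK.
  have -> : (\int[mu]_(x in Omega) (J x + t n * k n x)%:E =
      \int[mu]_(x in Omega) (J x)%:E + (t n)%:E * \int[mu]_(x in Omega) (k n x)%:E)%E.
    rewrite -(integralZl mO (ik n)) -integralD//; last exact: integrableZl.
  rewrite -(fineK (integrable_fin_num mO iJ)) -(fineK (integrable_fin_num mO (ik n))).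
  by rewrite -EFinM -EFinD lee_fin lerDl pmulr_rge0.
have [|||||iw _ cw] := @dominated_convergence _ _ _ mu Omega mO
    (fun n => EFin \o k n) (EFin \o w) (EFin \o dom).
- by move=> n; apply/measurable_EFinP.
- exact/measurable_EFinP.
- by apply: aeW => x Ox; apply: cvg_EFin; [exact: nearW|exact: kw].
- exact: idom.
- by apply: aeW => x n _; exact: kdom.
split => //.
apply: fine_ge0; apply: (cvge_ge _ cw); apply: nearW => n.
have := kge0 n; rewrite -lee_fin /Rintegral fineK//.
exact: (integrable_fin_num mO (ik n)).
Qed.

End first_variation.

(** * The Euler-Lagrange equation *)

Section euler_lagrange.
Context {R : realType} {N : nat}.
Implicit Types (Omega U K : set 'rV[R]_N) (f g u v phi : 'rV[R]_N -> R)
  (G H : 'rV[R]_N -> 'rV[R]_N) (p gamma lambdap lambdam : R).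

Local Notation mu := (@lebesgue_rV R N).

Lemma eq_loc_integrable U f g : {in U, f =1 g} ->
  loc_integrable U f -> loc_integrable U g.
Proof.
move=> fg [mf fi]; split; first exact: eq_measurable_fun mf.
move=> K cK KU; apply: eq_integrable (fi K cK KU).
- exact: rV_compact_measurable.
- by move=> x /set_mem/KU/mem_set/fg /= ->.
Qed.

(** A test function on [U] is one on [Omega], and the integrals see only its support. The change
    from [u] to [v] on [U] serves to pass to the positive part where it is positive. *)
Lemma weak_gradient_sub U Omega u v G : open U -> open Omega -> U `<=` Omega ->
  {in U, u =1 v} -> weak_gradient Omega u G -> weak_gradient U v G.
Proof.
move=> oU oO UO uv [lu lG uG]; split.
- by apply: (eq_loc_integrable uv); exact: loc_integrableS lu.
- by move=> i; exact: loc_integrableS (lG i).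
- move=> psi tpsi i; have [spsi cpsi psiU] := tpsi.
  have nK x : ~ U x -> ~ supp psi x by move=> + /psiU.
  have nO x : ~ Omega x -> ~ supp psi x by move=> + /psiU/UO.
  transitivity (\int[mu]_(x in U) (u x * partial i psi x)).
    by apply: eq_Rintegral => x xU; rewrite uv.
  have ext h : (forall x, ~ supp psi x -> h x = 0) ->
      \int[mu]_(x in U) h x = \int[mu]_(x in Omega) h x.
    move=> h0; rewrite Rintegral_zero_outside => [|x /nK/h0//].
    by rewrite -(@Rintegral_zero_outside _ _ Omega)// => x /nO/h0.
  rewrite ext => [|x /supp_partial_eq0 ->]; last by rewrite mulr0.
  rewrite uG; last exact: test_functionS tpsi.
  by rewrite ext// => x /supp_eq0 ->; rewrite mulr0.
Qed.

Lemma euler_lagrange_pos Omega p gamma lambdap lambdam v G :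
  open Omega -> (mu Omega < +oo)%E -> 1 < p -> 0 < gamma ->
  0 <= lambdap -> 0 <= lambdam -> {in Omega, continuous v} ->
  weak_gradient Omega v G ->
  mu.-integrable Omega (EFin \o (fun x => eucl_norm (G x) `^ p)) ->
  mu.-integrable Omega (EFin \o (fun x => eucl_norm (G x) `^ p / p +
    Fgamma gamma lambdap lambdam (v x))) ->
  test_minimizer Omega p gamma lambdap lambdam v G ->
  p_laplacian_eq ([set x | 0 < v^\+ x] `&` Omega) p v^\+
    (fun x => gamma * lambdap * (v^\+ x) `^ (gamma - 1)).
Proof.
move=> oO fO p1 g0 lp0 lm0 cv vG iG iJ vmin.
have [_ lG _] := vG.
pose U := [set x | 0 < v x] `&` Omega.
have -> : [set x | 0 < v^\+ x] `&` Omega = U.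
  by apply/seteqP; split => x [/= vx Ox]; split => //=; move: vx;
    rewrite /funrpos lt_max ltxx orbF.
have UO : U `<=` Omega by move=> x [].
have oU : open U.
  rewrite openE => x [/= vx Ox]; apply: filterI.
    exact: (cvgr_gt (v x) (cv x (mem_set Ox)) 0 vx).
  exact: open_nbhs_nbhs.
have mU := rV_open_measurable oU.
have mO := rV_open_measurable oO.
have vp : {in U, v =1 v^\+}.
  by move=> x /set_mem[/= vx _]; rewrite /funrpos max_l// ltW.
pose f x := gamma * lambdap * v x `^ (gamma - 1).
have lf : loc_integrable U f.
  apply: continuous_loc_integrable => // x /set_mem[/= vx Ox].
  have cpow : v y `^ (gamma - 1) @[y --> x] --> v x `^ (gamma - 1).
    apply: (@continuous_cvg _ _ _ (nbhs x) _ v (fun y : R => y `^ (gamma - 1))).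
      exact: continuous_powR.
    exact: cv (mem_set Ox).
  exact: (cvgM (cvg_cst (gamma * lambdap)) cpow).
have lfl i : loc_integrable U (fun x => p_flux p (G x) i).
  have mfl : measurable_fun Omega (fun x => p_flux p (G x) i).
    by apply: measurable_p_flux => j; have [] := lG j.
  split; first exact: measurable_funS mfl.
  move=> K cK KU; have mK := rV_compact_measurable cK.
  have KO := subset_trans KU UO.
  (* The flux is at most |G|^(p-1) <= 1 + |G|^p, integrable on [K]. *)
  apply: (@le_integrable _ _ _ _ _ mK _ (fun x => (1 + eucl_norm (G x) `^ p)%:E)).
  - by apply/measurable_EFinP; exact: measurable_funS mfl.
  - move=> x _ /=; rewrite lee_fin (le_trans (p_flux_le _ _ p1))//.
    rewrite (le_trans _ (ler_norm _))// powR_le1D ?eucl_norm_ge0//; lra.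
  - rewrite (_ : (fun _ => _) = (fun x => (1%:E + (eucl_norm (G x) `^ p)%:E)%E)); last exact/funext.
    apply: integrableD => //; last exact: integrableS iG.
    exact: finite_integrable_cst (rV_compact_finite cK).
exists G; first exact: weak_gradient_sub vp vG.
have fE : {in U, f =1 (fun x => gamma * lambdap * (v^\+ x) `^ (gamma - 1))}.
  by move=> x xU; rewrite /f vp.
split.
- move=> i; apply: eq_loc_integrable (lfl i) => x _.
  by rewrite mxE.
- exact: eq_loc_integrable fE lf.
move=> phi tphi; have [sphi cphi phiU] := tphi.
have tphiN := test_function_scale (-1) tphi.
have mG i : measurable_fun Omega (fun x => G x ord0 i) by have [] := lG i.
have [iw w0] := first_variation_ge0 oO fO p1 g0 lp0 lm0 cv mG iG iJ vmin tphi.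
have [iwN wN0] := first_variation_ge0 oO fO p1 g0 lp0 lm0 cv mG iG iJ vmin tphiN.
pose w x := \sum_i p_flux p (G x) i * partial i phi x + f x * phi x.
(* [w] is linear in [phi], so [wN0] says that the integral of the opposite of [w] is nonnegative as
   well. *)
have wO : \int[mu]_(x in Omega) w x = 0.
  apply/eqP; rewrite eq_le w0 andbT -oppr_ge0 -mulN1r -RintegralZl//.
  move: wN0; congr (0 <= _); apply: eq_Rintegral => x _.
  rewrite /w mulrDr mulr_sumr; congr (_ + _); last by rewrite /f/=; ring.
  by apply: eq_bigr => i _; rewrite partial_scale//=; ring.
have nU x : ~ U x -> ~ supp phi x by move=> + /phiU.
have nO x : ~ Omega x -> ~ supp phi x by move=> + /phiU/UO.
have w_eq0 x : ~ supp phi x -> w x = 0.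
  move=> nK; rewrite /w (supp_eq0 nK) mulr0 addr0 big1// => i _.
  by rewrite (supp_partial_eq0 _ nK) mulr0.
have wU : \int[mu]_(x in U) w x = 0.
  rewrite Rintegral_zero_outside => [|x /nU/w_eq0//].
  by rewrite -(@Rintegral_zero_outside _ _ Omega)// => x /nO/w_eq0.
have ifl i : mu.-integrable U (EFin \o (fun x => p_flux p (G x) i * partial i phi x)).
  apply: (loc_integrable_mul_integrable oU cphi) => //.
    exact: smooth_continuous_partial.
  by move=> x; exact: supp_partial_eq0.
have isum : mu.-integrable U (EFin \o (fun x => \sum_i p_flux p (G x) i * partial i phi x)).
  rewrite (_ : _ \o _ = (fun x => (\sum_i (p_flux p (G x) i * partial i phi x)%:E)%E)).
    by apply: integrable_sum => // i _; exact: ifl.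
  by apply/funext => x /=; rewrite sumEFin.
have ifphi : mu.-integrable U (EFin \o (fun x => f x * phi x)).
  apply: (loc_integrable_mul_integrable oU cphi) => //.
    exact: smooth_continuous.
  by move=> x; exact: supp_eq0.
move: wU; rewrite /w RintegralD// => /eqP; rewrite addr_eq0 => /eqP wU.
transitivity (- \int[mu]_(x in U) (\sum_i p_flux p (G x) i * partial i phi x)).
  congr (- _); apply: eq_Rintegral => x _.
  by apply: eq_bigr => i _; rewrite mxE.
by rewrite wU opprK; apply: eq_Rintegral => x xU; rewrite fE.
Qed.

End euler_lagrange.

(** * Sign reversal, change of representative, finiteness of the energy *)

Section minimizers.
Context {R : realType} {N : nat}.
Implicit Types (Omega U K : set 'rV[R]_N) (f g u v phi : 'rV[R]_N -> R)
  (G H : 'rV[R]_N -> 'rV[R]_N) (p gamma lambdap lambdam : R).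

Local Notation mu := (@lebesgue_rV R N).

Lemma eucl_normN (x : 'rV[R]_N) : eucl_norm (- x) = eucl_norm x.
Proof. by rewrite -scaleN1r eucl_normZ normrN1 mul1r. Qed.

Lemma FgammaN gamma lambdap lambdam (s : R) :
  Fgamma gamma lambdap lambdam (- s) = Fgamma gamma lambdam lambdap s.
Proof. by rewrite /Fgamma opprK addrC. Qed.

Lemma functionalJN Omega p gamma lambdap lambdam u G :
  functionalJ Omega p gamma lambdap lambdam (\- u) (fun x => - G x) =
  functionalJ Omega p gamma lambdam lambdap u G.
Proof. by apply: eq_integral => x _; rewrite eucl_normN FgammaN. Qed.

Lemma test_minimizerN Omega p gamma lambdap lambdam u G :
  test_minimizer Omega p gamma lambdap lambdam u G ->
  test_minimizer Omega p gamma lambdam lambdap (\- u) (fun x => - G x).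
Proof.
move=> umin phi tphi; have [sphi _ _] := tphi.
have E1 : \- u \+ phi = \- (u \+ (-1 \*o phi)).
  by apply/funext => x /=; rewrite opprD mulN1r opprK.
have E2 : (fun x => - G x + grad phi x) = (fun x => - (G x + grad (-1 \*o phi) x)).
  by apply/funext => x; rewrite grad_scale// opprD scaleN1r opprK.
rewrite E1 E2 !functionalJN.
exact: umin (test_function_scale (-1) tphi).
Qed.

Lemma weak_gradientN Omega u G : open Omega -> weak_gradient Omega u G ->
  weak_gradient Omega (\- u) (fun x => - G x).
Proof.
move=> oO [lu lG uG]; have mO := rV_open_measurable oO.
have lN f : loc_integrable Omega f -> loc_integrable Omega (\- f).
  move=> [mf fi]; split; first exact: measurableT_comp mf.
  move=> K cK KO; have mK := rV_compact_measurable cK.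
  rewrite (_ : _ \o _ = -%E \o (EFin \o f)); last exact/funext.
  by apply: integrableN; exact: fi.
split; first exact: lN.
- move=> i; rewrite (_ : (fun _ => _) = \- (fun x => G x ord0 i)); first exact: lN.
  by apply/funext => x; rewrite mxE.
- move=> psi tpsi i; have [spsi cpsi psiU] := tpsi.
  have i1 : mu.-integrable Omega (EFin \o (u \* partial i psi)).
    apply: (loc_integrable_mul_integrable oO cpsi) => //.
      exact: smooth_continuous_partial.
    by move=> x; exact: supp_partial_eq0.
  have i2 : mu.-integrable Omega (EFin \o ((fun x => G x ord0 i) \* psi)).
    apply: (loc_integrable_mul_integrable oO cpsi) => //.
      exact: smooth_continuous.
    exact: supp_eq0.
  transitivity (\int[mu]_(x in Omega) (-1 * (u x * partial i psi x))).
    by apply: eq_Rintegral => x _ /=; ring.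
  rewrite RintegralZl// uG// mulN1r; congr (- _).
  rewrite -mulN1r -RintegralZl//.
  by apply: eq_Rintegral => x _ /=; rewrite mxE; ring.
Qed.

Lemma ae_eq_integrable Omega (f g : 'rV[R]_N -> \bar R) : measurable Omega ->
  measurable_fun Omega g -> ae_eq mu Omega f g ->
  mu.-integrable Omega f -> mu.-integrable Omega g.
Proof.
move=> mO mg fg /integrableP[mf fi]; apply/integrableP; split => //.
suff -> : (\int[mu]_(x in Omega) `|g x| = \int[mu]_(x in Omega) `|f x|)%E by [].
apply: ae_eq_integral => //.
- exact: measurableT_comp.
- exact: measurableT_comp.
- by apply: filterS fg => x h /h ->.
Qed.

Lemma measurable_functionalJ Omega p gamma lambdap lambdam u G :
  measurable_fun Omega u -> (forall i, measurable_fun Omega (fun x => G x ord0 i)) ->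
  measurable_fun Omega (fun x => (eucl_norm (G x) `^ p / p +
    Fgamma gamma lambdap lambdam (u x))%:E).
Proof.
move=> mu_ mG; apply/measurable_EFinP; apply: measurable_funD.
  apply: measurable_funM => //; apply: (measurableT_comp (measurable_powR _)).
  exact: measurable_eucl_norm.
exact: (measurableT_comp (measurable_Fgamma _ _ _)).
Qed.

Lemma ae_eq_functionalJ Omega p gamma lambdap lambdam u v G :
  measurable Omega -> measurable_fun Omega u -> measurable_fun Omega v ->
  (forall i, measurable_fun Omega (fun x => G x ord0 i)) -> ae_eq mu Omega u v ->
  functionalJ Omega p gamma lambdap lambdam u G =
  functionalJ Omega p gamma lambdap lambdam v G.
Proof.
move=> mO mu_ mv mG uv; apply: ae_eq_integral => //.
- exact: measurable_functionalJ.
- exact: measurable_functionalJ.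
- by apply: filterS uv => x h /h ->.
Qed.

(** Minimality is given for [u], but the first variation needs the continuous version, which has an
    open positivity set and is bounded away from 0 on compact subsets of it. *)
Lemma ae_eq_test_minimizer Omega p gamma lambdap lambdam u v G :
  measurable Omega -> measurable_fun Omega u -> measurable_fun Omega v ->
  (forall i, measurable_fun Omega (fun x => G x ord0 i)) -> ae_eq mu Omega u v ->
  test_minimizer Omega p gamma lambdap lambdam u G ->
  test_minimizer Omega p gamma lambdap lambdam v G.
Proof.
move=> mO mu_ mv mG uv umin phi tphi; have [sphi _ _] := tphi.
have E1 := ae_eq_functionalJ p gamma lambdap lambdam mO mu_ mv mG uv.
have E2 : functionalJ Omega p gamma lambdap lambdam (u \+ phi)
    (fun x => G x + grad phi x) = functionalJ Omega p gamma lambdap lambdam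
    (v \+ phi) (fun x => G x + grad phi x).
  apply: (@ae_eq_functionalJ _ _ _ _ _ (u \+ phi) (v \+ phi) _ mO).
  - exact: measurable_funD mu_ (rV_continuous_measurableTS (smooth_continuous sphi)).
  - exact: measurable_funD mv (rV_continuous_measurableTS (smooth_continuous sphi)).
  - move=> i; rewrite (_ : (fun _ => _) = (fun x => G x ord0 i + partial i phi x)).
      exact: measurable_funD (mG i) (rV_continuous_measurableTS (smooth_continuous_partial sphi)).
    by apply/funext => x; rewrite !mxE.
  - by apply: filterS uv => x h /h /= ->.
have eqle (a b : \bar R) : a = b -> (a <= b)%E by move=> ->.
exact: (le_trans (eqle _ _ (esym E1)) (le_trans (umin _ tphi) (eqle _ _ E2))).
Qed.

Lemma ae_eq_weak_gradient Omega u v G : open Omega -> {in Omega, continuous v} ->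
  ae_eq mu Omega u v -> weak_gradient Omega u G -> weak_gradient Omega v G.
Proof.
move=> oO cv uv [[mu_ lu] lG uG]; have mO := rV_open_measurable oO.
have lv : loc_integrable Omega v by exact: continuous_loc_integrable.
have [mv _] := lv.
split => // psi tpsi i; rewrite -uG//; congr fine.
have [spsi _ _] := tpsi.
have mp : measurable_fun Omega (partial i psi).
  exact: rV_continuous_measurableTS (smooth_continuous_partial spsi).
apply: ae_eq_integral => //.
- by apply/measurable_EFinP; exact: measurable_funM.
- by apply/measurable_EFinP; exact: measurable_funM.
- by apply: filterS uv => x h /h ->.
Qed.

Lemma in_Lp_integrable Omega p f : 1 <= p -> measurable Omega -> in_Lp Omega p f ->
  mu.-integrable Omega (EFin \o (fun x => `|f x| `^ p)).
Proof.
move=> p1 mO /(Lfun_integrable p1) h.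
apply: eq_integrable (integrableS measurableT mO (@subsetT _ _) h) => // x xO.
by rewrite /= patchE xO.
Qed.

Lemma in_Lp_grad_integrable Omega p G : 1 <= p -> measurable Omega ->
  (forall i, measurable_fun Omega (fun x => G x ord0 i)) ->
  (forall i, in_Lp Omega p (fun x => G x ord0 i)) ->
  mu.-integrable Omega (EFin \o (fun x => eucl_norm (G x) `^ p)).
Proof.
move=> p1 mO mG LG; have p0 : 0 < p by exact: lt_le_trans p1.
apply: (@le_integrable _ _ _ _ _ mO _
  (fun x => ((N%:R `^ p)%:E * \sum_i (`|G x ord0 i| `^ p)%:E)%E)).
- apply/measurable_EFinP; apply: (measurableT_comp (measurable_powR _)).
  exact: measurable_eucl_norm.
- move=> x _; rewrite sumEFin -EFinM /= lee_fin ger0_norm ?powR_ge0//.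
  by rewrite (le_trans (eucl_norm_powR_le _ p0))// ler_norm.
- apply: integrableZl => //; apply: integrable_sum => // i _.
  exact: in_Lp_integrable (LG i).
Qed.

(** Since [gamma < p], each power in F_gamma is at most 1 + |u|^p, and the constant is integrable
    because [Omega] has finite measure. *)
Lemma Fgamma_integrable Omega p gamma lambdap lambdam u : 1 <= p ->
  0 < gamma < p -> 0 <= lambdap -> 0 <= lambdam -> measurable Omega ->
  (mu Omega < +oo)%E -> measurable_fun Omega u -> in_Lp Omega p u ->
  mu.-integrable Omega (EFin \o (fun x => Fgamma gamma lambdap lambdam (u x))).
Proof.
move=> p1 /andP[g0 gp] l0 m0 mO fO mu_ Lu.
apply: (@le_integrable _ _ _ _ _ mO _
  (fun x => ((lambdap + lambdam)%:E * (1%:E + (`|u x| `^ p)%:E))%E)).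
- by apply/measurable_EFinP; exact: (measurableT_comp (measurable_Fgamma _ _ _)).
- move=> x _; rewrite -EFinD -EFinM /= lee_fin ger0_norm ?Fgamma_ge0//.
  rewrite (le_trans _ (ler_norm _))// mulrDl.
  have h (s : R) : Num.max s 0 `^ gamma <= 1 + `|s| `^ p.
    apply: (@le_trans _ _ (`|s| `^ gamma)).
      rewrite ge0_ler_powR ?nnegrE ?(ltW g0)//; first by rewrite le_max lexx orbT.
      by rewrite ge_max ler_norm normr_ge0.
    by rewrite powR_le1D// (ltW g0) ltW.
  rewrite /Fgamma; apply: lerD; first exact: ler_wpM2l (h _).
  by rewrite -(normrN (u x)); exact: ler_wpM2l (h _).
- apply: integrableZl => //; apply: integrableD => //.
    exact: finite_integrable_cst.
  exact: in_Lp_integrable.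
Qed.

End minimizers.

Theorem theorem3p3 (R : realType) (N : nat) (Omega : set 'rV[R]_N)
    (p gamma lambdap lambdam : R) (u v : 'rV[R]_N -> R) :
  (0 < N)%N ->
  open Omega -> bounded_set Omega -> lipschitz_boundary Omega ->
  1 < p -> 0 < gamma < p -> 0 < lambdap -> 0 < lambdam ->
  in_W1p Omega p u ->
  local_minimizer Omega p gamma lambdap lambdam u ->
  continuous_representative Omega u v ->
  p_laplacian_eq ([set x | 0 < v^\+ x] `&` Omega) p v^\+
    (fun x => gamma * lambdap * (v^\+ x) `^ (gamma - 1)) /\
  p_laplacian_eq ([set x | 0 < v^\- x] `&` Omega) p v^\-
    (fun x => gamma * lambdam * (v^\- x) `^ (gamma - 1)).
Proof.
move=> N0 oO bO _ p1 /andP[g0 gp] lp0 lm0 [Lu [G uG LG]] umin [cv vu].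
have mO := rV_open_measurable oO.
have fO := bounded_set_finite mO bO.
have [[mu_ _] lG _] := uG.
have mG i : measurable_fun Omega (fun x => G x ord0 i) by have [] := lG i.
have mv : measurable_fun Omega v by exact: rV_continuous_measurable.
have uv : ae_eq (lebesgue_rV N) Omega u v.
  by apply: filterS vu => x h /h ->.
have vG := ae_eq_weak_gradient oO cv uv uG.
have vmin : test_minimizer Omega p gamma lambdap lambdam v G.
  apply: (ae_eq_test_minimizer mO mu_ mv mG uv).
  by apply: local_minimizer_test => //; exact: ltW.
have iG := in_Lp_grad_integrable (ltW p1) mO mG LG.
have iJ : (lebesgue_rV N).-integrable Omega (EFin \o (fun x =>
    eucl_norm (G x) `^ p / p + Fgamma gamma lambdap lambdam (v x))).
  apply: (@ae_eq_integrable _ _ _ (EFin \o (fun x =>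
    eucl_norm (G x) `^ p / p + Fgamma gamma lambdap lambdam (u x)))) => //.
  - exact: measurable_functionalJ.
  - by apply: filterS uv => x h /h /= ->.
  rewrite (_ : _ \o _ = (fun x => ((p^-1)%:E * (eucl_norm (G x) `^ p)%:E +
      (Fgamma gamma lambdap lambdam (u x))%:E)%E)); last first.
    by apply/funext => x /=; rewrite -EFinM -EFinD [p^-1 * _]mulrC.
  apply: integrableD => //; first exact: integrableZl.
  by apply: (Fgamma_integrable (ltW p1)) => //; [rewrite g0|exact: ltW|exact: ltW].
split.
  exact: (euler_lagrange_pos oO fO p1 g0 (ltW lp0) (ltW lm0) cv vG iG iJ vmin).
have cvN : {in Omega, continuous (\- v)} by move=> x xO; exact: (cvgN (cv x xO)).
have iGN : (lebesgue_rV N).-integrable Omega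
    (EFin \o (fun x => eucl_norm (- G x) `^ p)).
  by apply: eq_integrable iG => // x _ /=; rewrite eucl_normN.
have iJN : (lebesgue_rV N).-integrable Omega (EFin \o (fun x =>
    eucl_norm (- G x) `^ p / p + Fgamma gamma lambdam lambdap (- v x))).
  by apply: eq_integrable iJ => // x _ /=; rewrite eucl_normN FgammaN.
(* The negative part of [v] is the positive part of its opposite. *)
rewrite -funrposN.
exact: (euler_lagrange_pos oO fO p1 g0 (ltW lm0) (ltW lp0) cvN
  (weak_gradientN oO vG) iGN iJN (test_minimizerN vmin)).
Qed.
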